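(* Let $p,n\in\mathbb{N}$ and let the discrete Dirac system $$y_{k+1}(\lambda)=\Big(I_{2p}-\frac{\mathrm{i}}{\lambda}jC_k\Big)y_k(\lambda),\qquad C_k>0,\quad C_kjC_k=j\quad(k\ge0),$$ be determined (as described in the context) by some admissible triple $\{\mathcal{A},\mathcal{S}_0,\Pi_0\}$, and write $\Pi_0=\begin{bmatrix}\vartheta_1&\vartheta_2\end{bmatrix}$ with $n\times p$ blocks $\vartheta_1,\vartheta_2$. Put $$\widetilde{\mathcal{A}}:=\mathcal{A}+\mathrm{i}\,\vartheta_2(\vartheta_2-\vartheta_1)^*\mathcal{S}_0^{-1}.$$ Then $\widetilde{\mathcal{A}}+\mathrm{i}I_n$ is invertible, and the set of $p\times p$ matrices $\{\nu\}\cup\{s_{-k}\}$ ($0\le k<\infty$) corresponding to this Dirac system (equivalently, the matrix $\nu=\nu^*$ and the semi-infinite block Toeplitz matrix with blocks $s_{k-i}$, $s_k=s_{-k}^*$), that is, the set determined by the Weyl function $\varphi$ of the system via $$\mathrm{i}\,\varphi\Big(\mathrm{i}\,\frac{z+1}{z-1}\Big)=\alpha_0+\sum_{k=1}^\infty s_{-k}z^k\quad (|z|<1),\qquad \nu=\Im(\alpha_0),\quad s_0=\alpha_0+\alpha_0^*,$$ is given explicitly by the formulas $$\nu=\Im\big(I_p+2\mathrm{i}\,\vartheta_1^*\mathcal{S}_0^{-1}(\widetilde{\mathcal{A}}+\mathrm{i}I_n)^{-1}\vartheta_2\big),$$ $$s_0=2\,\Re\big(I_p+2\mathrm{i}\,\vartheta_1^*\mathcal{S}_0^{-1}(\widetilde{\mathcal{A}}+\mathrm{i}I_n)^{-1}\vartheta_2\big),$$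 $$s_{-k}=2\mathrm{i}\,\vartheta_1^*\mathcal{S}_0^{-1}(\widetilde{\mathcal{A}}+\mathrm{i}I_n)^{-1}\,\mathcal{U}^{k-1}(\mathcal{U}-I_n)\vartheta_2\qquad(k\ge1),$$ where $$\mathcal{U}=(\widetilde{\mathcal{A}}-\mathrm{i}I_n)(\widetilde{\mathcal{A}}+\mathrm{i}I_n)^{-1}.$$
   Context: Notation: $j=\begin{bmatrix}I_p&0\\0&-I_p\end{bmatrix}$; $A^*$ is the conjugate transpose of $A$; $S>0$ means positive definite; for a square matrix $\alpha$, $\Im(\alpha)=\frac1{2\mathrm{i}}(\alpha-\alpha^* )$ and $\Re(\alpha)=\frac12(\alpha+\alpha^* )$; $\mathbb{C}_-$ is the open lower half-plane. Admissible triple: a triple of $n\times n$ matrices $\mathcal{A}$, $\mathcal{S}_0$ and an $n\times 2p$ matrix $\Pi_0$ is admissible if $$\mathcal{A}\mathcal{S}_0-\mathcal{S}_0\mathcal{A}^*=\mathrm{i}\,\Pi_0\,j\,\Pi_0^*,\qquad\det\mathcal{A}\ne0,\qquad\mathcal{S}_0>0.$$ Dirac system determined by an admissible triple: the potential $\{C_k\}_{k\ge0}$ is defined, starting from $\Pi_0$ and $S_0=\mathcal{S}_0$, by $$\Pi_{k+1}=\Pi_k+\mathrm{i}\,\mathcal{A}^{-1}\Pi_kj,\qquad S_{k+1}=S_k+\mathcal{A}^{-1}S_k(\mathcal{A}^* )^{-1}+\mathcal{A}^{-1}\Pi_k\Pi_k^*(\mathcal{A}^* )^{-1},$$ $$C_k:=I_{2p}+\Pi_k^*S_k^{-1}\Pi_k-\Pi_{k+1}^*S_{k+1}^{-1}\Pi_{k+1}\qquad(k\ge0).$$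 It is known that these $C_k$ satisfy $C_k>0$ and $C_kjC_k=j$. Weyl function: let $W_0(\lambda)=I_{2p}$, $W_{k+1}(\lambda)=(I_{2p}-\frac{\mathrm{i}}{\lambda}jC_k)W_k(\lambda)$. A $p\times p$ matrix function $\varphi$ holomorphic in $\mathbb{C}_-$ is called a Weyl function of the Dirac system if for all $\lambda\in\mathbb{C}_-$ $$\sum_{k=0}^\infty\begin{bmatrix}\mathrm{i}\varphi(\lambda)^*&I_p\end{bmatrix}q(\lambda)^kKW_k(\lambda)^*C_kW_k(\lambda)K^*\begin{bmatrix}-\mathrm{i}\varphi(\lambda)\\ I_p\end{bmatrix}<\infty,$$ where $q(\lambda)=|\lambda|^2(|\lambda|^2+1)^{-1}$ and $K=\frac1{\sqrt2}\begin{bmatrix}I_p&-I_p\\ I_p&I_p\end{bmatrix}$. The Weyl function is known to exist and be unique. For the Dirac system determined by an admissible triple it is known to be $$\varphi(\lambda)=-\mathrm{i}\big(I_p-\phi(\lambda)\big)\big(I_p+\phi(\lambda)\big)^{-1},\quad \phi(\lambda)=-\mathrm{i}\,\vartheta_1^*\mathcal{S}_0^{-1}\big(\mathcal{A}^{\times}-\lambda I_n\big)^{-1}\vartheta_2,\quad \mathcal{A}^{\times}=\mathcal{A}+\mathrm{i}\,\vartheta_2\vartheta_2^*\mathcal{S}_0^{-1}.$$ *)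

(* Defs.v *)
From HB Require Import structures.
From mathcomp Require Import all_boot all_order all_algebra.
From mathcomp Require Import all_classical all_reals all_analysis.
From mathcomp Require Import complex.

Set Implicit Arguments.
Unset Strict Implicit.
Unset Printing Implicit Defensive.

Import Order.TTheory GRing.Theory Num.Theory.
Import numFieldNormedType.Exports.

Local Open Scope ring_scope.
Local Open Scope classical_set_scope.
Local Open Scope sesquilinear_scope.

(* The complex numbers, packaged as a numClosedFieldType so that the topology
   and normed-module structures of mathcomp-analysis (for Cx R itself and,
   entrywise, for matrices over it) are inferred. The norm `|z| and the order
   are those of numClosedFieldType: they take values in Cx R, and 0 < x
   entails that x is real. *)
Definition Cx (R : realType) : numClosedFieldType := R[i].

Section MatrixNotions.
Context {R : realType}.
Local Notation C := (Cx R).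

Definition posdefmx n (M : 'M[C]_n) : Prop :=
  M \is hermsymmx /\
  forall v : 'cV[C]_n, v != 0 -> 0 < (v ^t* *m M *m v) 0 0.

(* Not the entrywise imaginary and real parts. *)
Definition Immx n (M : 'M[C]_n) : 'M[C]_n := (2 * 'i)^-1 *: (M - M ^t*).
Definition Remx n (M : 'M[C]_n) : 'M[C]_n := 2^-1 *: (M + M ^t*).

Definition jmx p : 'M[C]_(p + p) := block_mx 1%:M 0 0 (- 1%:M).

Definition Kmx p : 'M[C]_(p + p) :=
  (sqrtC 2)^-1 *: block_mx 1%:M (- 1%:M) 1%:M 1%:M.

End MatrixNotions.

Arguments jmx {R} p.
Arguments Kmx {R} p.

Section AdmissibleTriple.
Context {R : realType} {n p : nat}.
Local Notation C := (Cx R).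

Definition admissible (A S0 : 'M[C]_n) (Pi0 : 'M[C]_(n, p + p)) : Prop :=
  [/\ A *m S0 - S0 *m A ^t* = 'i *: (Pi0 *m jmx p *m Pi0 ^t*),
      \det A != 0 & posdefmx S0].

Fixpoint triple_Pi (A : 'M[C]_n) (Pi0 : 'M[C]_(n, p + p)) (k : nat) :
    'M[C]_(n, p + p) :=
  if k is k'.+1 then
    triple_Pi A Pi0 k' + 'i *: (invmx A *m triple_Pi A Pi0 k' *m jmx p)
  else Pi0.

Fixpoint triple_S (A S0 : 'M[C]_n) (Pi0 : 'M[C]_(n, p + p))
    (k : nat) : 'M[C]_n :=
  if k is k'.+1 then
    triple_S A S0 Pi0 k'
    + invmx A *m triple_S A S0 Pi0 k' *m invmx (A ^t*)
    + invmx A *m triple_Pi A Pi0 k' *m (triple_Pi A Pi0 k') ^t*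
        *m invmx (A ^t*)
  else S0.

Definition triple_potential (A S0 : 'M[C]_n) (Pi0 : 'M[C]_(n, p + p))
    (k : nat) : 'M[C]_(p + p) :=
  let G i := (triple_Pi A Pi0 i) ^t* *m invmx (triple_S A S0 Pi0 i)
               *m triple_Pi A Pi0 i in
  1%:M + G k - G k.+1.

End AdmissibleTriple.

Section DiracSystem.
Context {R : realType} {p : nat}.
Local Notation C := (Cx R).
Implicit Types (c : nat -> 'M[C]_(p + p)) (phi : C -> 'M[C]_p).

(* A discrete Dirac system is represented by its potential c. *)
Definition dirac_potential c : Prop :=
  forall k, posdefmx (c k) /\ c k *m jmx p *m c k = jmx p.

Fixpoint dirac_W c (lambda : C) (k : nat) : 'M[C]_(p + p) :=
  if k is k'.+1 then
    (1%:M - ('i / lambda) *: (jmx p *m c k')) *m dirac_W c lambda k'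
  else 1%:M.

Definition lower_half_plane : set C := [set lambda | 'Im lambda < 0].

Definition holomorphic_on (D : set C) phi : Prop :=
  forall lambda, D lambda -> derivable phi lambda 1.

Definition weyl_q (lambda : C) : C := `|lambda| ^+ 2 / (`|lambda| ^+ 2 + 1).

Definition weyl_term c phi (lambda : C) (k : nat) : 'M[C]_p :=
  row_mx ('i *: (phi lambda) ^t*) 1%:M
  *m (weyl_q lambda ^+ k *:
       (Kmx p *m (dirac_W c lambda k) ^t* *m c k *m dirac_W c lambda k
          *m (Kmx p) ^t*))
  *m col_mx (- 'i *: phi lambda) 1%:M.

(* The terms of the series are positive semidefinite, so that its sum being
   finite is its convergence. *)
Definition weyl_function c phi : Prop :=
  holomorphic_on lower_half_plane phi /\
  forall lambda, lower_half_plane lambda ->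
    cvgn (series (weyl_term c phi lambda)).

(* nu and the blocks s k (k an integer) of the semi-infinite block Toeplitz
   matrix with entries s (k - i) corresponding to the Dirac system with potential c:
   those read off the Taylor coefficients of its Weyl function. *)
Definition toeplitz_data c (nu : 'M[C]_p) (s : int -> 'M[C]_p) : Prop :=
  exists phi (alpha0 : 'M[C]_p),
  [/\ weyl_function c phi,
      forall z : C, `|z| < 1 ->
        (fun N => alpha0 + \sum_(1 <= k < N) z ^+ k *: s (- k%:Z)) @ \oo -->
          ('i *: phi ('i * ((z + 1) / (z - 1))) : 'M[C]_p),
      nu = Immx alpha0,
      s 0 = alpha0 + alpha0 ^t* &
      forall k : int, s k = (s (- k)) ^t*].

End DiracSystem.

(* Main.v *)
Require Import Defs.
From mathcomp Require Import all_boot all_order all_algebra.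
From mathcomp Require Import all_classical all_reals all_analysis.
From mathcomp Require Import complex ring.

Import Order.TTheory GRing.Theory Num.Theory.
Import numFieldNormedType.Exports.

Local Open Scope ring_scope.
Local Open Scope sesquilinear_scope.
Set Implicit Arguments.
Unset Strict Implicit.
Unset Printing Implicit Defensive.

(** Write q = |l|^2 / (|l|^2 + 1). The relations C_k j C_k = j turn the Dirac
recursion into an energy identity,
   q^r W_r^* j W_r = j + d (sum over k < r of q^k W_k^* C_k W_k),
where d = - 2 Im l / (|l|^2 + 1) is positive on the lower half-plane
([dirac_step], [signature_energy]). The series in the definition of a Weyl
function is therefore controlled by the indefinite form j.

A Weyl function is unique because C_k >= j: a nonzero vector v with
v^* j v >= 0 has q^k v^* W_k^* C_k W_k v >= d v^* C_0 v > 0 for all k >= 1, so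
its series diverges. If two Weyl functions differed at l, the difference of the
two convergent directions would contain a nonzero vector isotropic for j
([weyl_value_unique]).

For an admissible triple, solutions of the system are explicit:
   y_k = e_k - i j Pi_k^* S_k^-1 x_k,   (A - l) x_k = Pi_k e_k,
with e_k = (1 + i/l)^k e_0 and j e_0 = - e_0 ([darboux_solution]). The matrix A
may have eigenvalues in the lower half-plane, so x_k is carried along by a
recursion and A - l is never inverted. The energy of y_k is
- |e_k|^2 + 2 Im l (x_k^* S_k^-1 x_k) <= 0 ([darboux_energy]), hence its series
has bounded partial sums. Put At = A + i theta2 (theta2 - theta1)^* S0^-1. Then
At S0 - S0 At^* = i (theta1 - theta2)(theta1 - theta2)^*
([tilde_identity]), so At - l is invertible on the lower half-plane, and the
choice x_0 = (At - l)^-1 theta2 shows that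
   i phi(l) = 1 + 2 i theta1^* S0^-1 (At - l)^-1 theta2
defines the Weyl function ([explicit_weyl_function]). The right-hand side equals
(1 - f(l)) (1 + f(l))^-1 with f(l) = - i theta1^* S0^-1 (Ax - l)^-1 theta2 and
Ax = A + i theta2 theta2^* S0^-1: inverting 1 + f(l) replaces Ax by At.

Finally, for l = i (z + 1)/(z - 1) one has
   (1 - z)(At - l) = (1 - z U)(At + i),   U = (At - i)(At + i)^-1,
so the Taylor coefficients at z = 0 are those of a geometric series in U. The
identity for At also says that U S0 U^* <= S0; the powers of U are thus bounded
and the series converges for |z| < 1 ([explicit_weyl_taylor]). Convergent power
series have unique coefficients ([matrix_power_series_eq]), which turns the
uniqueness of the Weyl function into uniqueness of nu and of the blocks. *)

(** * Adjoints of complex matrices *)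

Section Adjoint.
Context {C : numClosedFieldType}.

Lemma adjmxM m n p (M : 'M[C]_(m, n)) (N : 'M[C]_(n, p)) :
  (M *m N) ^t* = N ^t* *m M ^t*.
Proof. by rewrite trmx_mul map_mxM. Qed.

Lemma adjmxD m n (M N : 'M[C]_(m, n)) : (M + N) ^t* = M ^t* + N ^t*.
Proof. by rewrite linearD map_mxD. Qed.

Lemma adjmxN m n (M : 'M[C]_(m, n)) : (- M) ^t* = - M ^t*.
Proof. by rewrite linearN map_mxN. Qed.

Lemma adjmxZ m n a (M : 'M[C]_(m, n)) : (a *: M) ^t* = a^* *: M ^t*.
Proof. by rewrite linearZ map_mxZ. Qed.

Lemma adjmx1 n : (1%:M : 'M[C]_n) ^t* = 1%:M.
Proof. by rewrite trmx1 map_mx1. Qed.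

Lemma adjmxV n (M : 'M[C]_n) : (invmx M) ^t* = invmx (M ^t*).
Proof. by rewrite trmx_inv map_invmx. Qed.

Definition adjmxE := (adjmxM, adjmxD, adjmxN, adjmxZ, adjmx1, @trmxCK).

Lemma adjmx_gram m n (B : 'M[C]_(m, n)) : (B ^t* *m B) ^t* = B ^t* *m B.
Proof. by rewrite adjmxM trmxCK. Qed.

Lemma adjmx_congr m n (B : 'M[C]_(m, n)) (M : 'M[C]_n) : M ^t* = M ->
  (B *m M *m B ^t*) ^t* = B *m M *m B ^t*.
Proof. by move=> hM; rewrite !adjmxE hM mulmxA. Qed.

Lemma right_inverse_adj n (S Si : 'M[C]_n) :
  S ^t* = S -> S *m Si = 1%:M -> Si ^t* = Si.
Proof.
move=> Sadj SSi; rewrite -[LHS]mulmx1 -SSi mulmxA.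
by rewrite -[S in Si ^t* *m S]Sadj -adjmxM SSi adjmx1 mul1mx.
Qed.

End Adjoint.

Lemma addmxE (V : nmodType) m n (M N : 'M[V]_(m, n)) i j :
  (M + N) i j = M i j + N i j.
Proof. by rewrite mxE. Qed.

Lemma oppmxE (V : zmodType) m n (M : 'M[V]_(m, n)) i j : (- M) i j = - M i j.
Proof. by rewrite mxE. Qed.

Lemma scalemxE (R : pzRingType) m n a (M : 'M[R]_(m, n)) i j :
  (a *: M) i j = a * M i j.
Proof. by rewrite mxE. Qed.

Lemma zeromxE (V : nmodType) m n i j : (0 : 'M[V]_(m, n)) i j = 0.
Proof. by rewrite mxE. Qed.

(** Sums of matrix products are brought to a normal form in which every
monomial is a scaled, left-associated product. *)
Ltac mxexpand :=
  rewrite ?(mulmxDl, mulmxDr, mulNmx, mulmxN, scalerDr, scalerN, =^~ scalemxAl,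
    =^~ scalemxAr, scalerA, mulmxA, mulmx1, mul1mx, scale1r, mul_mx_scalar,
    mul_scalar_mx).

(** An identity that is linear in its monomials holds entrywise, where it is
a commutative ring identity. *)
Ltac mxlin := apply/matrixP => ? ?;
  rewrite ?(addmxE, oppmxE, scalemxE, zeromxE); ring.

(** * Quadratic forms of matrices *)

Section QuadraticForm.
Context {C : numClosedFieldType}.

Definition qform n (M : 'M[C]_n) (v : 'cV[C]_n) : C := (v ^t* *m M *m v) 0 0.

Lemma qformD n (M N : 'M[C]_n) v : qform (M + N) v = qform M v + qform N v.
Proof. by rewrite /qform mulmxDr mulmxDl mxE. Qed.

Lemma qformN n (M : 'M[C]_n) v : qform (- M) v = - qform M v.
Proof. by rewrite /qform mulmxN mulNmx mxE. Qed.

Lemma qformZ n a (M : 'M[C]_n) v : qform (a *: M) v = a * qform M v.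
Proof. by rewrite /qform -scalemxAr -scalemxAl mxE. Qed.

Lemma qform_congr m n (M : 'M[C]_n) (B : 'M[C]_(n, m)) v :
  qform (B ^t* *m M *m B) v = qform M (B *m v).
Proof. by rewrite /qform adjmxM !mulmxA. Qed.

Lemma qform_sum n r (M : 'I_r -> 'M[C]_n) v :
  qform (\sum_(k < r) M k) v = \sum_(k < r) qform (M k) v.
Proof. by rewrite /qform mulmx_sumr mulmx_suml summxE. Qed.

Lemma qform_delta n (M : 'M[C]_n) i : qform M (delta_mx i 0) = M i i.
Proof. by rewrite /qform trmx_delta map_delta_mx -rowE -colE !mxE. Qed.

Lemma qform1_ge0 n (v : 'cV[C]_n) : 0 <= qform 1%:M v.
Proof.
rewrite /qform mulmx1 mxE sumr_ge0 // => i _.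
by rewrite !mxE mulrC mul_conjC_ge0.
Qed.

Lemma qform_gram_ge0 m n (B : 'M[C]_(n, m)) v : 0 <= qform (B ^t* *m B) v.
Proof. by rewrite -[B ^t*]mulmx1 qform_congr qform1_ge0. Qed.

(** The difference of the two sides is the value of the form at u + v. *)
Lemma qform_sub_le n (M : 'M[C]_n) u v : (forall w, 0 <= qform M w) ->
  qform M (u - v) <= 2 * (qform M u + qform M v).
Proof.
move=> M0; rewrite -subr_ge0.
suff -> : 2 * (qform M u + qform M v) - qform M (u - v) = qform M (u + v).
  exact: M0.
by rewrite /qform !adjmxE; mxexpand; rewrite !(addmxE, oppmxE); ring.
Qed.

(** Cauchy-Schwarz in additive form: the difference of the two sides is the
value of the nonnegative form M at u - N v. *)
Lemma cross_term_le n (M N : 'M[C]_n) u v : M ^t* = M -> N ^t* = N ->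
  M *m N = 1%:M -> (forall w, 0 <= qform M w) ->
  (u ^t* *m v) 0 0 + (v ^t* *m u) 0 0 <= qform M u + qform N v.
Proof.
move=> Madj Nadj MN M0; rewrite -subr_ge0.
suff -> : qform M u + qform N v - ((u ^t* *m v) 0 0 + (v ^t* *m u) 0 0) =
          qform M (u - N *m v) by [].
rewrite /qform !adjmxE Nadj; mxexpand.
rewrite -!(mulmxA _ M N) MN -!(mulmxA _ N M) (mulmx1C MN) !mulmx1.
rewrite !(addmxE, oppmxE).
ring.
Qed.

Lemma qform_scaled n (M : 'M[C]_n) a v :
  qform M (a *: v) = a * a^* * qform M v.
Proof.
by rewrite /qform adjmxZ -!scalemxAl -scalemxAr scalerA mxE (mulrC a).
Qed.

(** Evaluating T S - S T^* on a left eigenvector of T locates the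
eigenvalue, as the sign of the left-hand side is known. *)
Lemma qform_left_eigen n (T S : 'M[C]_n) l w :
  w ^t* *m T = l *: w ^t* ->
  qform (T *m S - S *m T ^t*) w = (l - l^*) * qform S w.
Proof.
move=> wT; have Tw : T ^t* *m w = l^* *: w.
  by rewrite -[w in LHS]trmxCK -adjmxM wT adjmxZ trmxCK.
rewrite qformD qformN mulrBl; congr (_ - _).
  by rewrite /qform mulmxA wT -!scalemxAl mxE.
rewrite /qform (mulmxA (w ^t*)) -(mulmxA _ (T ^t*)) Tw.
by rewrite -scalemxAr mxE.
Qed.

(** The entries of M are recovered from values of its quadratic form, which
reduces convergence of matrices to that of nonnegative numbers. *)
Lemma polarization n (M : 'M[C]_n) i j :
  let e k : 'cV[C]_n := delta_mx k 0 in
  M i j = 4^-1 * (qform M (e i + e j) - qform M (e i - e j)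
    - 'i * qform M (e i + 'i *: e j) + 'i * qform M (e i - 'i *: e j)).
Proof.
move=> e.
have entry k l : ((e k) ^t* *m M *m e l) 0 0 = M k l.
  by rewrite trmx_delta map_delta_mx -rowE -colE !mxE.
rewrite /qform !adjmxE conjCi; mxexpand.
rewrite !(addmxE, oppmxE, scalemxE) !entry.
have ii : 'i * 'i = -1 :> C by rewrite -expr2 sqrCi.
transitivity (4^-1 * (2 * M i j + 2 * M j i + 'i * 'i * (2 * M j i - 2 * M i j))).
  by rewrite ii; field.
by ring.
Qed.

End QuadraticForm.

Section Positivity.
Context {R : realType}.
Local Notation C := (Cx R).

Lemma posdefmx_adj n (M : 'M[C]_n) : posdefmx M -> M ^t* = M.
Proof.
by case=> /is_hermitianmxP M1 _; rewrite [RHS]M1 expr0 scale1r.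
Qed.

Lemma posdefmx_intro n (M : 'M[C]_n) :
  M ^t* = M -> (forall v, v != 0 -> 0 < qform M v) -> posdefmx M.
Proof.
by move=> M1; split => //; apply/is_hermitianmxP; rewrite expr0 scale1r.
Qed.

Lemma posdefmx_ge0 n (M : 'M[C]_n) v : posdefmx M -> 0 <= qform M v.
Proof.
move=> [_ M0]; have [->|/M0/ltW //] := eqVneq v 0.
by rewrite /qform mulmx0 mxE.
Qed.

(** Injectivity is tested on rows, so that an identity T S - S T^* can be
evaluated on left eigenvectors of T. *)
Lemma unitmx_inj n (M : 'M[C]_n) :
  (forall w : 'cV[C]_n, w ^t* *m M = 0 -> w = 0) -> M \in unitmx.
Proof.
move=> inj; rewrite unitmxE unitfE; apply/det0P => -[u u0 uM].
case/negP: u0; rewrite -[u]trmxCK (inj (u ^t*)) ?trmxCK //.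
by rewrite trmx0 map_mx0.
Qed.

Lemma posdefmx_unit n (M : 'M[C]_n) : posdefmx M -> M \in unitmx.
Proof.
move=> [_ M0]; apply: unitmx_inj => w wM; apply/eqP/negPn/negP => /M0.
by rewrite wM mul0mx mxE ltxx.
Qed.

Lemma posdefmx_congr n (M B : 'M[C]_n) :
  posdefmx M -> B \in unitmx -> posdefmx (B ^t* *m M *m B).
Proof.
move=> hM uB; apply: posdefmx_intro.
  by rewrite !adjmxE (posdefmx_adj hM) mulmxA.
move=> v v0; rewrite qform_congr; apply: hM.2; apply: contraNneq v0 => Bv.
by rewrite -[v](mulKmx uB) Bv mulmx0.
Qed.

Lemma posdefmx_inv n (M : 'M[C]_n) : posdefmx M -> posdefmx (invmx M).
Proof.
move=> hM; have uM := posdefmx_unit hM.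
have -> : invmx M = (invmx M) ^t* *m M *m invmx M.
  by rewrite adjmxV (posdefmx_adj hM) mulVmx // mul1mx.
by apply: posdefmx_congr; rewrite ?unitmx_inv.
Qed.

Lemma posdefmxD n (M N : 'M[C]_n) : posdefmx M -> N ^t* = N ->
  (forall v, 0 <= qform N v) -> posdefmx (M + N).
Proof.
move=> hM N1 N0; apply: posdefmx_intro; first by rewrite adjmxD (posdefmx_adj hM) N1.
by move=> v v0; rewrite qformD ltr_pwDl // hM.2.
Qed.

End Positivity.

(** * Limits of matrices *)

Section MatrixTopology.
Local Open Scope classical_set_scope.
Context {K : numFieldType} {m n : nat}.

(** The topology of matrices is given by entrywise balls, and there are
finitely many entries. *)
Lemma cvg_mxP (T : Type) (F : set_system T) (FF : Filter F)
    (f : T -> 'M[K]_(m, n)) (M : 'M[K]_(m, n)) :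
  f @ F --> M <-> forall i j, (fun t => f t i j) @ F --> M i j.
Proof.
split=> [fM i j|fM].
  exact: (cvg_comp _ _ fM (@coord_continuous K m n i j M)).
apply/cvg_ballP => e e0.
have: \forall t \near F, forall i j, ball (M i j) e (f t i j).
  apply: filter_forall => i; apply: filter_forall => j.
  exact: (cvg_ball (fM i j)).
by apply: filterS => t ft; split.
Qed.

End MatrixTopology.

Section MatrixLimits.
Local Open Scope classical_set_scope.
Context {K : numFieldType} {T : Type} {F : set_system T} {FF : Filter F}.

Lemma cvg_mulmx m n k (f : T -> 'M[K]_(m, n)) (g : T -> 'M[K]_(n, k))
    (M : 'M[K]_(m, n)) (N : 'M[K]_(n, k)) :
  f @ F --> M -> g @ F --> N -> (fun t => f t *m g t) @ F --> M *m N.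
Proof.
move=> /cvg_mxP fM /cvg_mxP gN; apply/cvg_mxP => i j; rewrite mxE.
under eq_cvg do rewrite mxE.
by apply: cvg_big => [|l _]; [exact: add_continuous | exact: cvgM].
Qed.

Lemma cvg_det n (f : T -> 'M[K]_n) (M : 'M[K]_n) : f @ F --> M ->
  \det (f t) @[t --> F] --> \det M.
Proof.
move=> /cvg_mxP fM; apply: cvg_big => [|s _]; first exact: add_continuous.
apply: cvgM; first exact: cvg_cst.
by apply: cvg_big => [|i _]; [exact: mul_continuous | exact: fM].
Qed.

Lemma cvg_adjugate n (f : T -> 'M[K]_n) (M : 'M[K]_n) : f @ F --> M ->
  \adj (f t) @[t --> F] --> \adj M.
Proof.
move=> /cvg_mxP fM; apply/cvg_mxP => i j; rewrite mxE.
under eq_cvg do rewrite mxE.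
apply: cvgM; first exact: cvg_cst.
apply: cvg_det; apply/cvg_mxP => k l; rewrite !mxE.
under eq_cvg do rewrite !mxE.
exact: fM.
Qed.

(** Invertibility is an open condition, as the determinant is continuous. *)
Lemma near_unitmx n (f : T -> 'M[K]_n) (M : 'M[K]_n) : f @ F --> M -> M \in unitmx ->
  \forall t \near F, f t \in unitmx.
Proof.
move=> /cvg_det dM; rewrite unitmxE unitfE => /(cvgr_neq0 _ dM).
by apply: filterS => t; rewrite unitmxE unitfE.
Qed.

Lemma cvg_invmx n (f : T -> 'M[K]_n) (M : 'M[K]_n) : f @ F --> M -> M \in unitmx ->
  invmx (f t) @[t --> F] --> invmx M.
Proof.
move=> fM uM; have dM := cvg_det fM.
have d0 : \det M != 0 by rewrite -unitfE -unitmxE.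
rewrite {2}/invmx uM.
have : (\det (f t))^-1 *: \adj (f t) @[t --> F] --> (\det M)^-1 *: \adj M.
  apply/cvg_mxP => i j; rewrite mxE; under eq_cvg do rewrite mxE.
  by apply: cvgM; [exact: cvgV | have /cvg_mxP := cvg_adjugate fM].
apply: cvg_trans; apply: near_eq_cvg.
by apply: filterS (near_unitmx fM uM) => t ut; rewrite /invmx ut.
Qed.

End MatrixLimits.

Section ComplexConvergence.
Local Open Scope classical_set_scope.
Local Open Scope complex_scope.
Context {R : realType}.
Local Notation C := (Cx R).

Lemma cvg_real_complex (u : nat -> R) (a : R) : u @ \oo --> a ->
  (fun k => (u k)%:C : C) @ \oo --> (a%:C : C).
Proof.
move=> ua; apply/cvgrPdist_lt => e e0.
have /andP[/eqP Ie Re0] : (complex.Im e == 0) && (0 < complex.Re e).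
  by move: e0; rewrite ltcE /= eq_sym.
have eE : e = (complex.Re e)%:C by case: e Ie {e0 Re0} => x y /= ->.
move/cvgrPdist_lt: ua => /(_ _ Re0); apply: filterS => k uk.
rewrite eE -rmorphB normc_def /= expr0n addr0 sqrtr_sqr ltcR.
exact: uk.
Qed.

(** The order of the complex numbers makes the terms real, so that this is
the monotone convergence theorem for the real parts. *)
Lemma cvg_series_ge0_bounded (u : nat -> C) (B : C) : (forall k, 0 <= u k) ->
  (forall N, \sum_(k < N) u k <= B) -> cvgn (series u).
Proof.
move=> u0 uB; pose r k := complex.Re (u k).
have ru k : (r k)%:C = u k by apply: RRe_real; rewrite ger0_real.
have sr N : series u N = (series r N)%:C.
  by rewrite /series /= rmorph_sum; apply: eq_bigr => k _; exact: esym (ru k).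
have r0 k : 0 <= r k by have := u0 k; rewrite lecE => /andP[].
have cr : cvgn (series r).
  apply: nondecreasing_is_cvgn; first exact: nondecreasing_series.
  exists (complex.Re B) => _ [N _ <-].
  have := uB N; rewrite -(big_mkord xpredT) -[\sum_(_ <= _ < _) _]/(series u N).
  by rewrite sr lecE => /andP[].
apply/cvg_ex; exists ((limn (series r))%:C).
by rewrite (_ : series u = fun N => (series r N)%:C) //;
  [exact: cvg_real_complex | apply/funext].
Qed.

Lemma cvg_expr_lt1 (z : C) : `|z| < 1 -> (fun k => z ^+ k) @ \oo --> (0 : C).
Proof.
move=> z1; pose r := complex.Re `|z|.
have rz : r%:C = `|z| by apply: RRe_real; rewrite normr_real.
have r0 : 0 <= r by rewrite -ler0c rz normr_ge0.
have r1 : `|r| < 1 by rewrite ger0_norm // -ltcR rz.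
have /cvgrPdist_lt rk0 := cvg_real_complex (cvg_expr r1).
apply/cvgrPdist_lt => e /rk0; apply: filterS => k.
by rewrite rmorphXn /= rz !sub0r !normrN !normrX normr_id.
Qed.

End ComplexConvergence.

Section MatrixSequences.
Local Open Scope classical_set_scope.

Context {R : realType}.
Local Notation C := (Cx R).

(** Each quadratic form gives a series of nonnegative terms with bounded
sums; polarization then gives convergence of the entries. *)
Lemma cvg_series_psd n (T : nat -> 'M[C]_n) (B : 'cV[C]_n -> C) :
  (forall k v, 0 <= qform (T k) v) ->
  (forall N v, \sum_(k < N) qform (T k) v <= B v) -> cvgn (series T).
Proof.
move=> T0 TB.
have cq v : cvgn (series (fun k => qform (T k) v)).
  by apply: (@cvg_series_ge0_bounded _ _ (B v)) => [k|N]; [exact: T0|exact: TB].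
pose e k : 'cV[C]_n := delta_mx k 0.
pose L v : C := limn (series (fun k => qform (T k) v)).
pose M := \matrix_(i, j) (4^-1 * (L (e i + e j) - L (e i - e j)
    - 'i * L (e i + 'i *: e j) + 'i * L (e i - 'i *: e j))).
apply/cvg_ex; exists M; apply/cvg_mxP => i j; rewrite mxE.
have Lq v : (fun N => qform (series T N) v) @ \oo --> L v.
  rewrite (_ : (fun N => _) = series (fun k => qform (T k) v)); first exact: cq.
  by apply/funext => N; rewrite /series /= !big_mkord qform_sum.
rewrite (_ : (fun N => _) = fun N => 4^-1 * (qform (series T N) (e i + e j)
    - qform (series T N) (e i - e j) - 'i * qform (series T N) (e i + 'i *: e j)
    + 'i * qform (series T N) (e i - 'i *: e j))); last first.
  by apply/funext => N; exact: polarization.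
apply: cvgM; first exact: cvg_cst.
apply: cvgD; first apply: cvgB; first by apply: cvgB; exact: Lq.
  by apply: cvgM; [exact: cvg_cst | exact: Lq].
by apply: cvgM; [exact: cvg_cst | exact: Lq].
Qed.

Lemma cvg_scaled_powers n (U : 'M[C]_n) (z : C) :
  (forall i j, exists c, forall k, `|(U ^+ k) i j| <= c) -> `|z| < 1 ->
  (fun k => z ^+ k *: U ^+ k) @ \oo --> (0 : 'M[C]_n).
Proof.
move=> bU z1; apply/cvg_mxP => i j; have [c hc] := bU i j.
rewrite mxE; under eq_cvg do rewrite mxE.
have c0 : 0 <= c by apply: le_trans (hc 0%N).
apply/cvgrPdist_lt => e e0; have e1 : 0 < e / (c + 1).
  by rewrite divr_gt0 // ltr_wpDl // ltr01.
have /cvgrPdist_lt/(_ _ e1) := cvg_expr_lt1 z1; apply: filterS => k.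
rewrite !sub0r !normrN normrM => zk.
have : `|z ^+ k| * `|(U ^+ k) i j| <= e / (c + 1) * c.
  by apply: ler_pM => //; exact: ltW.
move=> /le_lt_trans; apply; rewrite mulrAC ltr_pdivrMr.
  by rewrite ltr_pM2l // ltrDl ltr01.
by rewrite ltr_wpDl // ltr01.
Qed.

End MatrixSequences.

(** * A power series determines its coefficients *)

Section PowerSeries.
Local Open Scope classical_set_scope.
Context {K : numFieldType}.

Lemma geometric_sum_le2 (y : K) N : 0 <= y -> y <= 2^-1 -> \sum_(k < N) y ^+ k <= 2.
Proof.
move=> y0 y1.
have twohalves : 2^-1 + 2^-1 = 1 :> K by field.
have half : 2^-1 <= 1 - y by rewrite lerBrDr -{2}twohalves lerD2l.
have pos : 0 < 1 - y by apply: lt_le_trans half; rewrite invr_gt0 ltr0n.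
rewrite -(ler_pM2l pos) -[1 - y in leLHS]opprB mulNr -subrX1 opprB.
apply: (@le_trans _ _ 1); first by rewrite gerBl exprn_ge0.
by move: half; rewrite -(@ler_pM2r _ 2) ?ltr0n // mulVf ?pnatr_eq0.
Qed.

(** Convergence at z = 1/2 bounds the coefficients by M 2^k, so for small
x > 0 the terms of positive degree add up to at most 4 M x. Since all partial
sums tend to 0, the constant term is bounded by 4 M x for arbitrarily small x. *)
Lemma power_series_constant_term (e : nat -> K) :
  (forall z : K, z != 0 -> `|z| < 1 ->
     (fun N => \sum_(k < N) z ^+ k * e k) @ \oo --> (0 : K)) -> e 0%N = 0.
Proof.
move=> he; apply/eqP/negPn/negP => e0.
have half1 : `|2^-1 : K| < 1.
  by rewrite ger0_norm ?invr_ge0 ?ler0n // invf_lt1 ?ltr0n // ltr1n.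
have half0 : 2^-1 != 0 :> K by rewrite invr_eq0 pnatr_eq0.
have term0 : (fun k => 2^-1 ^+ k * e k) @ \oo --> (0 : K).
  have h := he _ half0 half1; have h' := h.
  rewrite -(cvg_shiftS (fun N => \sum_(k < N) 2^-1 ^+ k * e k)) in h'.
  rewrite -[X in _ --> X](subrr (0 : K)); apply: cvg_trans (cvgB h' h).
  apply: near_eq_cvg; apply: nearW => k /=.
  by rewrite fctE big_ord_recr /= addrAC subrr add0r.
have [M M0 eM] : exists2 M : K, 0 < M & forall k, `|e k| <= M * 2 ^+ k.
  have /cvgrPdist_lt/(_ 1 ltr01)[N _ hN] := term0.
  have pow k : 1 <= 2 ^+ k :> K by rewrite exprn_ege1 // ler1n.
  have S0 : 0 <= \sum_(k < N) `|e k| by apply: sumr_ge0.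
  exists (1 + \sum_(k < N) `|e k|) => [|k]; first by rewrite ltr_pwDl.
  have [kN|Nk] := ltnP k N.
    apply: (@le_trans _ _ ((1 + \sum_(k < N) `|e k|) * 1)).
      rewrite mulr1 (bigD1 (Ordinal kN)) //= addrCA lerDl addr_ge0 //.
      by apply: sumr_ge0.
    by rewrite ler_wpM2l ?addr_ge0.
  have := hN k Nk; rewrite /= sub0r normrN normrM normrX.
  rewrite ger0_norm ?invr_ge0 ?ler0n // exprVn => /ltW.
  rewrite ler_pdivrMl ?exprn_gt0 ?ltr0n // mulr1 => /le_trans; apply.
  by rewrite ler_peMl ?exprn_ge0 ?ler0n // lerDl.
pose a := `|e 0%N|; have a0 : 0 < a by rewrite normr_gt0.
have Ma : 0 < M + a by rewrite addr_gt0.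
(* Small enough for 2 x <= 1/2 and 4 M x <= a / 4. *)
pose x := a / (16 * (M + a)).
have x0 : 0 < x by rewrite divr_gt0 // mulr_gt0 ?ltr0n.
have x2 : x * 2 <= 2^-1.
  rewrite /x mulrAC ler_pdivrMr ?mulr_gt0 ?ltr0n //.
  have -> : 2^-1 * (16 * (M + a)) = 8 * M + 6 * a + a * 2 by field.
  by rewrite lerDr addr_ge0 // mulr_ge0 ?ler0n // ltW.
have xM : 4 * (M * x) <= a / 4.
  have -> : 4 * (M * x) = M * (a / 4) / (M + a).
    by rewrite /x; field; rewrite gt_eqF.
  rewrite ler_pdivrMr // mulrC ler_wpM2l ?lerDl ?(ltW a0) //.
  by rewrite divr_ge0 ?ler0n // ltW.
have x1 : `|x| < 1.
  rewrite gtr0_norm //; apply: (@lt_le_trans _ _ (x * 2)).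
    by rewrite mulr_natr mulr2n ltrDl.
  by rewrite (le_trans x2) // invf_le1 ?ltr0n // ler1n.
clearbody x; have a2 : 0 < a / 2 by rewrite divr_gt0 ?ltr0n.
have /cvgrPdist_lt/(_ _ a2)[N _ /(_ N.+1 (leqnSn N))] := he x (lt0r_neq0 x0) x1.
rewrite /= sub0r normrN big_ord_recl expr0 mul1r.
set r := \sum_(i < N) _ => small.
have rle : `|r| <= a / 4.
  apply: le_trans xM; apply: le_trans (ler_norm_sum _ _ _) _.
  apply: (@le_trans _ _ (\sum_(i < N) (2 * (M * x)) * (x * 2) ^+ i)).
    apply: ler_sum => i _; rewrite normrM normrX (gtr0_norm x0) lift0.
    apply: le_trans (ler_wpM2l _ (eM _)) _; first by rewrite exprn_ge0 ?ltW.
    rewrite !exprS [(x * 2) ^+ i]exprMn le_eqVlt; apply/orP; left; apply/eqP.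
    by move: (2 ^+ i) (x ^+ i) => u w; ring.
  rewrite -mulr_sumr.
  have -> : 4 * (M * x) = 2 * (M * x) * 2 by ring.
  by rewrite ler_wpM2l ?geometric_sum_le2 ?mulr_ge0 ?ler0n ?(ltW x0) ?(ltW M0).
have : a <= `|e 0%N + r| + `|r|.
  by rewrite /a -{1}[e 0%N](addrK r); exact: ler_normB.
move=> /le_lt_trans/(_ (ltr_leD small rle)).
have -> : a / 2 + a / 4 = a - a / 4 by field.
by rewrite ltrBrDr gtrDl lt_gtF ?divr_gt0 ?ltr0n.
Qed.

(** Once the constant term vanishes, the series can be divided by z. *)
Lemma power_series_eq0 (e : nat -> K) :
  (forall z : K, z != 0 -> `|z| < 1 ->
     (fun N => \sum_(k < N) z ^+ k * e k) @ \oo --> (0 : K)) ->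
  forall k, e k = 0.
Proof.
move=> he k; elim: k e he => [|k IH] e he; first exact: power_series_constant_term.
apply: (IH (fun k => e k.+1)) => z z0 z1.
have e0 := power_series_constant_term he.
have h := he z z0 z1.
rewrite -(cvg_shiftS (fun N => \sum_(k < N) z ^+ k * e k)) in h.
rewrite -[X in _ --> X](mulr0 (z^-1)); apply: cvg_trans (cvgM (cvg_cst _) h).
apply: near_eq_cvg; apply: nearW => N /=.
rewrite ?fctE /= big_ord_recl e0 mulr0 add0r mulr_sumr; apply: eq_bigr => i _.
by rewrite lift0 exprS -mulrA mulKf.
Qed.

Lemma matrix_power_series_eq p (F : K -> 'M[K]_p) (a b : 'M[K]_p)
    (s t : nat -> 'M[K]_p) :
  (forall z : K, `|z| < 1 ->
     (fun N => a + \sum_(1 <= k < N) z ^+ k *: s k) @ \oo --> F z) ->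
  (forall z : K, `|z| < 1 ->
     (fun N => b + \sum_(1 <= k < N) z ^+ k *: t k) @ \oo --> F z) ->
  a = b /\ forall k, (0 < k)%N -> s k = t k.
Proof.
move=> has hbt.
(* The coefficients of the entrywise difference, degree 0 included. *)
pose e i j k := if k is k'.+1 then s k i j - t k i j else a i j - b i j.
have e0 i j k : e i j k = 0.
  apply: power_series_eq0 => z z0 z1.
  have /cvg_mxP/(_ i j) := has z z1.
  rewrite -(cvg_shiftS (fun N => (a + \sum_(1 <= k < N) z ^+ k *: s k) i j)) => h1.
  have /cvg_mxP/(_ i j) := hbt z z1.
  rewrite -(cvg_shiftS (fun N => (b + \sum_(1 <= k < N) z ^+ k *: t k) i j)) => h2.
  have : (fun N => \sum_(k < N.+1) z ^+ k * e i j k) @ \oo --> (0 : K).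
    rewrite (_ : (fun N => _) = fun N =>
      (a + \sum_(1 <= k < N.+1) z ^+ k *: s k) i j -
      (b + \sum_(1 <= k < N.+1) z ^+ k *: t k) i j).
      by rewrite -(subrr (F z i j)); exact: cvgB h1 h2.
    apply/funext => N; rewrite !addmxE !summxE big_ord_recl expr0 mul1r.
    rewrite opprD addrACA -sumrB; congr (_ + _).
    rewrite big_add1 big_mkord; apply: eq_bigr => k' _.
    by rewrite !scalemxE lift0 -mulrBr.
  by rewrite (cvg_shiftS (fun N => \sum_(k < N) z ^+ k * e i j k)).
split=> [|[//|k] _]; apply/matrixP => i j; apply/eqP; rewrite -subr_eq0; apply/eqP.
  exact: (e0 i j 0%N).
exact: (e0 i j k.+1).
Qed.

End PowerSeries.

(** * The energy identity and the uniqueness of Weyl functions *)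

Section SignatureAlgebra.
Context {C : numClosedFieldType}.

Lemma signature_step m (j c : 'M[C]_m) (a : C) : j ^t* = j -> j *m j = 1%:M ->
  c ^t* = c -> c *m j *m c = j ->
  (1%:M - a *: (j *m c)) ^t* *m j *m (1%:M - a *: (j *m c)) =
  (1 + a^* * a) *: j - (a^* + a) *: c.
Proof.
move=> jadj jj cadj cjc; rewrite !adjmxE jadj cadj; mxexpand.
by rewrite -!(mulmxA _ j j) jj; mxexpand; rewrite cjc; mxlin.
Qed.

(** As c^-1 = j c j, this writes c - j as a congruence of c; so c > 0
implies c >= j. *)
Lemma signature_gap m (j c : 'M[C]_m) : j ^t* = j -> j *m j = 1%:M ->
  c ^t* = c -> c *m j *m c = j ->
  c - j = 2^-1 *: ((j *m (c - j)) ^t* *m c *m (j *m (c - j))).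
Proof.
move=> jadj jj cadj cjc; rewrite !adjmxE jadj cadj.
have -> : (c - j) *m j *m c *m (j *m (c - j)) = 2 *: (c - j).
  have -> : (c - j) *m j *m c = j - c by rewrite !mulmxBl cjc jj mul1mx.
  by rewrite mulmxA !(mulmxBl, mulmxBr) cjc jj !mul1mx -(mulmxA c) jj mulmx1; mxlin.
by rewrite scalerA mulVf ?scale1r ?pnatr_eq0.
Qed.

(** The term of the Weyl series is a congruence of the energy density by the
initial value K^* X of a solution. *)
Lemma adjmx_sandwich m p a (K W M : 'M[C]_m) (X : 'M[C]_(m, p)) :
  X ^t* *m (a *: (K *m W ^t* *m M *m W *m K ^t*)) *m X =
  (K ^t* *m X) ^t* *m (a *: (W ^t* *m M *m W)) *m (K ^t* *m X).
Proof. by rewrite !adjmxE; mxexpand. Qed.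

(** Conjugation by K turns the signature matrix into an off-diagonal one,
for which the first block of coordinates is isotropic. *)
Lemma rotation_mul p (r : C) : r * r = 2^-1 ->
  let K : 'M[C]_(p + p) := r *: block_mx 1%:M (- 1%:M) 1%:M 1%:M in
  let K' : 'M[C]_(p + p) := r *: block_mx 1%:M 1%:M (- 1%:M) 1%:M in
  K *m K' = 1%:M /\
  K *m block_mx 1%:M 0 0 (- 1%:M) *m K' = block_mx 0 1%:M 1%:M 0.
Proof.
move=> rr K K'.
have two : 2^-1 *: (1%:M + 1%:M) = 1%:M :> 'M[C]_p.
  have -> : 1%:M + 1%:M = 2 *: 1%:M :> 'M[C]_p by rewrite scaler_nat mulr2n.
  by rewrite scalerA mulVf ?pnatr_eq0 // scale1r.
rewrite /K /K' -!scalemxAl -!scalemxAr !scalerA rr !mulmx_block.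
rewrite ?(mulmx1, mul1mx, mulmx0, mul0mx, mulmxN, mulNmx, oppr0, opprK).
rewrite ?(addr0, add0r, subr0, sub0r, subrr, addNr, opprK, oppr0).
by rewrite !scale_block_mx !scaler0 two -scalar_mx_block; split.
Qed.

End SignatureAlgebra.

Section SignatureRecursion.
Context {C : numClosedFieldType} {m : nat}.
Variables (j : 'M[C]_m) (c N W : nat -> 'M[C]_m) (q d : C).
Hypotheses (W0 : W 0%N = 1%:M) (WS : forall k, W k.+1 = N k *m W k).
Hypothesis step : forall k, q *: ((N k) ^t* *m j *m N k) = j + d *: c k.

Let density k := q ^+ k *: ((W k) ^t* *m c k *m W k).

(** Telescoping of the one-step identity for the recursion W. *)
Lemma signature_energy r :
  q ^+ r *: ((W r) ^t* *m j *m W r) = j + d *: \sum_(k < r) density k.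
Proof.
elim: r => [|r IH].
  by rewrite big_ord0 scaler0 addr0 expr0 scale1r W0 adjmx1 mul1mx mulmx1.
rewrite big_ord_recr /= scalerDr addrA -IH WS adjmxM exprSr -scalerA.
have -> : (W r) ^t* *m (N r) ^t* *m j *m (N r *m W r) =
          (W r) ^t* *m ((N r) ^t* *m j *m N r) *m W r by rewrite !mulmxA.
rewrite [q *: _]scalemxAl [q *: _]scalemxAr step /density.
rewrite scalerA (mulrC d) -(scalerA (q ^+ r)).
by rewrite -scalerDr; congr (_ *: _); mxexpand.
Qed.

Hypotheses (q0 : 0 <= q) (d0 : 0 <= d).
Hypothesis c0 : forall k v, 0 <= qform (c k) v.

Lemma density_ge0 k v : 0 <= qform (density k) v.
Proof. by rewrite /density qformZ qform_congr mulr_ge0 ?exprn_ge0. Qed.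

(** Since c k >= j, the density at step k dominates q^k W_k^* j W_k, which by
the energy identity is at least d times the first term of the sum. *)
Lemma density_lower_bound k v : (forall v, qform j v <= qform (c k) v) ->
  0 <= qform j v -> (0 < k)%N -> d * qform (c 0%N) v <= qform (density k) v.
Proof.
case: k => // k jc jv _.
apply: (@le_trans _ _ (qform (q ^+ k.+1 *: ((W k.+1) ^t* *m j *m W k.+1)) v)).
  rewrite signature_energy qformD ler_wpDl // qformZ ler_wpM2l //.
  rewrite qform_sum big_ord_recl {1}/density expr0 scale1r W0 adjmx1 mul1mx mulmx1.
  by rewrite lerDl sumr_ge0 // => i _; exact: density_ge0.
by rewrite /density !qformZ !qform_congr ler_wpM2l ?exprn_ge0.
Qed.

End SignatureRecursion.

Section Dirac.
Context {R : realType} {p : nat}.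
Local Notation C := (Cx R).
Implicit Types (c : nat -> 'M[C]_(p + p)) (phi : C -> 'M[C]_p) (l : C).

Lemma jmx_adj : (jmx p : 'M[C]_(p + p)) ^t* = jmx p.
Proof.
by rewrite /jmx tr_block_mx map_block_mx !trmx0 !map_mx0 adjmxN !adjmx1.
Qed.

Lemma jmx_sqr : jmx p *m jmx p = 1%:M :> 'M[C]_(p + p).
Proof.
rewrite /jmx mulmx_block !mulmx0 !mul0mx !mulmx1 mulmxN mulmx1 opprK.
by rewrite !addr0 !add0r -scalar_mx_block.
Qed.

Lemma lower_half_plane_neq0 l : lower_half_plane l -> l != 0.
Proof. by apply: contraPneq => ->; rewrite /lower_half_plane /= raddf0 ltxx. Qed.

Lemma weyl_q_gt0 l : l != 0 -> 0 < weyl_q l.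
Proof.
by move=> l0; rewrite /weyl_q divr_gt0 ?exprn_gt0 ?normr_gt0.
Qed.

(** On the lower half-plane this is - 2 Im l / (|l|^2 + 1), the constant d of
the energy identity. *)
Definition weyl_rate l : C := weyl_q l * ('i * (l^*^-1 - l^-1)).

Lemma weyl_rate_gt0 l : lower_half_plane l -> 0 < weyl_rate l.
Proof.
move=> hl; have l0 := lower_half_plane_neq0 hl.
have cl0 : l^* != 0 by rewrite conjC_eq0.
have -> : weyl_rate l = - (2 * 'Im l) / (`|l| ^+ 2 + 1).
  rewrite /weyl_rate /weyl_q normCK ImE.
  have ? : l * l^* + 1 != 0.
    by rewrite -normCK gt_eqF // ltr_wpDl ?exprn_ge0 ?ltr01.
  by field; rewrite ?cl0 ?l0 ?andbT.
rewrite divr_gt0 ?ltr_wpDl ?exprn_ge0 ?ltr01 // oppr_gt0.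
by rewrite pmulr_rlt0 ?ltr0n.
Qed.

Lemma dirac_step c k l : dirac_potential c -> l != 0 ->
  weyl_q l *: ((1%:M - ('i / l) *: (jmx p *m c k)) ^t* *m jmx p
     *m (1%:M - ('i / l) *: (jmx p *m c k))) = jmx p + weyl_rate l *: c k.
Proof.
move=> /(_ k)[hk cjc] l0; have cl0 : l^* != 0 by rewrite conjC_eq0.
rewrite (signature_step _ jmx_adj jmx_sqr (posdefmx_adj hk) cjc).
have -> : (('i / l)^*)%R = - 'i / l^* by rewrite fmorph_div /= conjCi.
have -> : 1 + - 'i / l^* * ('i / l) = (weyl_q l)^-1.
  have -> : - 'i / l^* * ('i / l) = - ('i * 'i) / (l * l^*) by field; rewrite l0 cl0.
  rewrite -expr2 sqrCi opprK /weyl_q normCK.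
  have ? : l * l^* + 1 != 0.
    by rewrite -normCK gt_eqF // ltr_wpDl ?exprn_ge0 ?ltr01.
  by field; rewrite ?cl0 ?l0 ?andbT.
rewrite scalerBr !scalerA mulfV ?scale1r ?gt_eqF ?weyl_q_gt0 // -scaleNr.
by congr (_ + _ *: _); rewrite /weyl_rate; ring.
Qed.

Lemma jmx_le_potential c k v : dirac_potential c ->
  qform (jmx p) v <= qform (c k) v.
Proof.
move=> /(_ k)[hk cjc]; rewrite -subr_ge0 -qformN -qformD.
rewrite (signature_gap jmx_adj jmx_sqr (posdefmx_adj hk) cjc).
by rewrite qformZ qform_congr mulr_ge0 ?invr_ge0 ?ler0n ?posdefmx_ge0.
Qed.

Lemma Kmx_adj : (Kmx p) ^t* =
  (sqrtC 2)^-1 *: block_mx 1%:M 1%:M (- 1%:M) 1%:M :> 'M[C]_(p + p).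
Proof.
by rewrite /Kmx adjmxZ tr_block_mx map_block_mx !adjmxE geC0_conj.
Qed.

Let sqrt2V : (sqrtC 2)^-1 * (sqrtC 2)^-1 = 2^-1 :> C.
Proof. by rewrite -invfM -expr2 sqrtCK. Qed.

Lemma Kmx_isometry : Kmx p *m (Kmx p) ^t* = 1%:M :> 'M[C]_(p + p).
Proof. by rewrite Kmx_adj; case: (rotation_mul p sqrt2V). Qed.

Lemma Kmx_j : Kmx p *m jmx p *m (Kmx p) ^t* =
  block_mx 0 1%:M 1%:M 0 :> 'M[C]_(p + p).
Proof. by rewrite Kmx_adj; case: (rotation_mul p sqrt2V). Qed.

(** The initial values of the solutions that a Weyl function singles out. *)
Definition weyl_seed phi l : 'M[C]_(p + p, p) :=
  (Kmx p) ^t* *m col_mx (- 'i *: phi l) 1%:M.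

Lemma weyl_termE c phi l k : weyl_term c phi l k = (weyl_seed phi l) ^t* *m
  (weyl_q l ^+ k *: ((dirac_W c l k) ^t* *m c k *m dirac_W c l k)) *m
  weyl_seed phi l.
Proof.
rewrite /weyl_term /weyl_seed.
have -> : row_mx ('i *: (phi l) ^t*) 1%:M = (col_mx (- 'i *: phi l) 1%:M) ^t*.
  by rewrite tr_col_mx map_row_mx adjmxZ adjmx1 rmorphN /= conjCi opprK.
exact: adjmx_sandwich.
Qed.

Lemma dirac_density_lower_bound c l v k : dirac_potential c ->
  lower_half_plane l -> 0 <= qform (jmx p) v -> (0 < k)%N ->
  weyl_rate l * qform (c 0%N) v <=
  qform (weyl_q l ^+ k *: ((dirac_W c l k) ^t* *m c k *m dirac_W c l k)) v.
Proof.
move=> hc hl jv k0; have l0 := lower_half_plane_neq0 hl.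
apply: (@density_lower_bound _ _ (jmx p) c
  (fun k => 1%:M - ('i / l) *: (jmx p *m c k)) (dirac_W c l)) k0 => //.
- by move=> i; exact: dirac_step.
- exact: ltW (weyl_q_gt0 l0).
- exact: ltW (weyl_rate_gt0 hl).
- by move=> i w; apply: posdefmx_ge0; case: (hc i).
- by move=> w; exact: jmx_le_potential.
Qed.

End Dirac.

Section Uniqueness.
Local Open Scope classical_set_scope.
Context {R : realType} {p : nat}.
Local Notation C := (Cx R).

(** If the values differ on a vector g, then the difference v of the two
initial values is K^* (h, 0) with h nonzero. It is isotropic for j, so its energy
density stays above a positive constant; but by the parallelogram law it is at
most twice the sum of two terms that tend to 0. *)
Lemma weyl_value_unique (c : nat -> 'M[C]_(p + p)) (phi psi : C -> 'M[C]_p) l :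
  dirac_potential c -> lower_half_plane l ->
  cvgn (series (weyl_term c phi l)) -> cvgn (series (weyl_term c psi l)) ->
  phi l = psi l.
Proof.
move=> hc hl hphi hpsi; apply/matrixP => i j; apply/eqP/negPn/negP => neq.
pose g : 'cV[C]_p := delta_mx j 0.
pose h : 'cV[C]_p := - 'i *: ((phi l - psi l) *m g).
pose v := (Kmx p) ^t* *m col_mx h 0.
have vE : v = weyl_seed phi l *m g - weyl_seed psi l *m g.
  rewrite /v /weyl_seed -mulmxBl -mulmxBr opp_col_mx add_col_mx subrr.
  rewrite -scalerBr -mulmxA mul_col_mx mul0mx.
  by rewrite /h -scalemxAl.
have h0 : h != 0.
  rewrite scaler_eq0 oppr_eq0 (negPf (neq0Ci _)) /=.
  apply: contraNneq neq => /matrixP/(_ i 0).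
  by rewrite -colE !mxE => /eqP; rewrite subr_eq0.
have v0 : v != 0.
  apply: contraNneq h0 => v0; have : Kmx p *m v = 0 by rewrite v0 mulmx0.
  by rewrite mulmxA Kmx_isometry mul1mx => /eqP; rewrite col_mx_eq0 => /andP[].
have jv : qform (jmx p) v = 0.
  rewrite -qform_congr trmxCK Kmx_j /qform -mulmxA mul_block_col.
  rewrite !mulmx0 !mul0mx mul1mx !addr0 tr_col_mx map_row_mx.
  by rewrite mul_row_col trmx0 map_mx0 mul0mx mulmx0 addr0 mxE.
(* The lower bound for the energy density of v. *)
pose d := weyl_rate l * qform (c 0%N) v.
have d0 : 0 < d by rewrite mulr_gt0 ?weyl_rate_gt0 //; apply: (hc 0%N).1.2.
have lim0 f : cvgn (series (weyl_term c f l)) ->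
    (fun k => weyl_term c f l k j j) @ \oo --> (0 : C).
  move=> /cvg_series_cvg_0 /cvg_mxP/(_ j j).
  by rewrite mxE.
have lim2 : (fun k => weyl_term c phi l k j j + weyl_term c psi l k j j) @ \oo
    --> (0 : C).
  by rewrite -[X in _ --> X]addr0; apply: cvgD; apply: lim0.
have d2 : 0 < d / 2 by rewrite divr_gt0 ?ltr0n.
have [N _ /(_ N.+1 (leqnSn N)) /=] := (cvgrPdist_lt _ _).1 lim2 _ d2.
rewrite sub0r normrN; set x := (_ + _ : C) => small.
have : d <= 2 * x.
  apply: le_trans (dirac_density_lower_bound hc hl _ (ltn0Sn N)) _.
    by rewrite jv.
  rewrite vE /x -!(qform_delta (weyl_term _ _ _ _)) !weyl_termE !qform_congr.
  apply: qform_sub_le => w; rewrite qformZ qform_congr.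
  rewrite mulr_ge0 ?exprn_ge0 ?posdefmx_ge0 ?(ltW (weyl_q_gt0 _)) //.
    exact: lower_half_plane_neq0.
  by case: (hc N.+1).
rewrite mulrC -ler_pdivrMr ?ltr0n // => dx.
have x0 : 0 <= x by rewrite (le_trans _ dx) // divr_ge0 ?ler0n ?ltW.
by move: small; rewrite ger0_norm // => /(le_lt_trans dx); rewrite ltxx.
Qed.

End Uniqueness.

(** * Solutions of the Dirac system of an admissible triple *)

Section DarbouxStep.
Context {C : numClosedFieldType} {n m : nat}.
Variables (A Ai S S' : 'M[C]_n) (P P' : 'M[C]_(n, m)) (j : 'M[C]_m).
Hypotheses (AAi : A *m Ai = 1%:M) (AiA : Ai *m A = 1%:M).
Hypotheses (jj : j *m j = 1%:M) (jadj : j ^t* = j).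
Hypotheses (AS : A *m S - S *m A ^t* = 'i *: (P *m j *m P ^t*)).
Hypothesis (P'E : P' = P + 'i *: (Ai *m P *m j)).
Hypothesis (S'E : S' = S + Ai *m S *m Ai ^t* + Ai *m P *m P ^t* *m Ai ^t*).

Let jjK k (M : 'M[C]_(k, m)) : M *m j *m j = M.
Proof. by rewrite -mulmxA jj mulmx1. Qed.
Let AiAK' k (M : 'M[C]_(k, n)) : M *m Ai ^t* *m A ^t* = M.
Proof. by rewrite -mulmxA -adjmxM AAi adjmx1 mulmx1. Qed.

Let P'adj : P' ^t* = P ^t* - 'i *: (j *m P ^t* *m Ai ^t*).
Proof. by rewrite P'E !adjmxE jadj conjCi scaleNr mulmxA. Qed.

Let ii : 'i * 'i = -1 :> C. Proof. by rewrite -expr2 sqrCi. Qed.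

Let AS' : A *m S = S *m A ^t* + 'i *: (P *m j *m P ^t*).
Proof. by rewrite -AS addrC subrK. Qed.

Let jP : P *m j *m P ^t* = - 'i *: (A *m S - S *m A ^t*).
Proof. by rewrite AS scalerA mulNr ii opprK scale1r. Qed.

(** The identity A S - S A^* = i P j P^* is preserved by one step of the
recursion of the triple. *)
Lemma darboux_identity : A *m S' - S' *m A ^t* = 'i *: (P' *m j *m P' ^t*).
Proof.
have AiS : Ai *m S = S *m Ai ^t* - 'i *: (Ai *m P *m j *m P ^t* *m Ai ^t*).
  have -> : S *m Ai ^t* = Ai *m (A *m S) *m Ai ^t* by rewrite mulmxA AiA mul1mx.
  rewrite AS'; mxexpand.
  by rewrite -[_ *m A ^t* *m Ai ^t*]mulmxA -adjmxM AiA adjmx1 mulmx1 addrK.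
rewrite P'adj P'E S'E; mxexpand; rewrite AAi !mul1mx !AiAK' !jjK AS' AiS.
rewrite ii; mxexpand; mxlin.
Qed.

(** One step of the Dirac system maps y = e - i j P^* S^-1 x to the vector of
the same form built on P' and S'. Only the equation (A - l) x = P e is used, so l
may be an eigenvalue of A. *)
Lemma darboux_solution (Si Si' : 'M[C]_n) k (l : C) (x : 'M[C]_(n, k))
    (e : 'M[C]_(m, k)) :
  S *m Si = 1%:M -> Si' *m S' = 1%:M -> Si *m S = 1%:M -> l != 0 ->
  A *m x - l *: x = P *m e ->
  let c := 1%:M + P ^t* *m Si *m P - P' ^t* *m Si' *m P' in
  let e' := e - ('i / l) *: (j *m e) in
  exists2 x', A *m x' - l *: x' = P' *m e' &
  (1%:M - ('i / l) *: (j *m c)) *m (e - 'i *: (j *m P ^t* *m Si *m x)) =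
  e' - 'i *: (j *m P' ^t* *m Si' *m x').
Proof.
move=> SSi Si'S' SiS l0 xE c e'.
have Ax : A *m x = l *: x + P *m e by rewrite -xE addrC subrK.
have il : 'i * ('i / l) = - l^-1 by rewrite mulrA ii mulN1r.
have li : l * ('i / l) = 'i by rewrite mulrC divfK.
have SSiK r (M : 'M[C]_(r, n)) : M *m S *m Si = M by rewrite -mulmxA SSi mulmx1.
(* If A - l is invertible, this is the only solution of the equation for x'. *)
pose x' := x + l^-1 *: (Ai *m x) - ('i / l) *: (Ai *m P *m (j *m e)).
have x'E : A *m x' - l *: x' = P' *m e'.
  rewrite /e' /x' P'E; mxexpand; rewrite AAi !mul1mx !jjK -[Ai *m P *m e]mulmxA -xE.
  mxexpand; rewrite Ax AiA.
  rewrite il li divff // mulNr mulVf //.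
  by mxexpand; mxlin.
exists x' => //.
(* This relation is what makes the terms with P' and S' combine. *)
have P'x : P' *m (e - 'i *: (j *m P ^t* *m Si *m x)) + l *: x' =
    S' *m A ^t* *m Si *m x.
  rewrite S'E P'E /x'; mxexpand; rewrite !jjK !AiAK' jP; mxexpand.
  rewrite !SSiK ii mulrN ii opprK li Ax divff //.
  by mxexpand; mxlin.
set y := e - _ in P'x *.
have Py : P *m y = S *m A ^t* *m Si *m x - l *: x.
  rewrite /y; mxexpand; rewrite jP; mxexpand; rewrite SSiK Ax mulrN ii opprK.
  by mxexpand; mxlin.
have cy : c *m y = e - l *: (P ^t* *m Si *m x) + l *: (P' ^t* *m Si' *m x').
  have -> : c *m y = y + P ^t* *m Si *m (P *m y) - P' ^t* *m Si' *m (P' *m y).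
    by rewrite /c; mxexpand; mxlin.
  have -> : P' *m y = S' *m A ^t* *m Si *m x - l *: x' by rewrite -P'x addrK.
  rewrite Py; mxexpand; rewrite -!(mulmxA _ Si S) -(mulmxA _ Si' S') SiS Si'S'.
  by rewrite P'adj /y; mxexpand; rewrite AiAK'; mxlin.
have -> : (1%:M - ('i / l) *: (j *m c)) *m y = y - ('i / l) *: (j *m (c *m y)).
  by mxexpand; mxlin.
by rewrite cy /y /e'; mxexpand; rewrite divfK //; mxlin.
Qed.

(** The identity A S - S A^* = i P j P^* is used to eliminate P j P^*, and
the equation for x to eliminate P e. *)
Lemma darboux_energy Si k (l : C) (x : 'M[C]_(n, k)) (e : 'M[C]_(m, k)) :
  S *m Si = 1%:M -> Si *m S = 1%:M -> Si ^t* = Si ->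
  A *m x - l *: x = P *m e ->
  let y := e - 'i *: (j *m P ^t* *m Si *m x) in
  y ^t* *m j *m y = e ^t* *m j *m e + ('i * (l^* - l)) *: (x ^t* *m Si *m x).
Proof.
move=> SSi SiS Siadj xE y.
have xadj : e ^t* *m P ^t* = x ^t* *m A ^t* - l^* *: x ^t*.
  by rewrite -adjmxM -xE !adjmxE.
rewrite /y !adjmxE conjCi jadj Siadj; mxexpand; rewrite !jjK xadj.
have -> : x ^t* *m Si *m P *m j *m P ^t* *m Si *m x =
          - 'i *: (x ^t* *m Si *m A *m x - x ^t* *m A ^t* *m Si *m x).
  rewrite -!mulmxA (mulmxA j) (mulmxA P) (mulmxA P) jP; mxexpand.
  by rewrite -(mulmxA _ Si S) SiS -(mulmxA _ S Si) SSi; mxexpand.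
have -> : x ^t* *m Si *m P *m e = x ^t* *m Si *m A *m x - l *: (x ^t* *m Si *m x).
  by rewrite -mulmxA -xE; mxexpand.
by mxexpand; rewrite ?(mulrN, mulNr, ii, opprK); mxexpand; mxlin.
Qed.

End DarbouxStep.

Section Triple.
Context {R : realType} {n p : nat}.
Local Notation C := (Cx R).
Variables (A S0 : 'M[C]_n) (Pi0 : 'M[C]_(n, p + p)).
Hypothesis hadm : admissible A S0 Pi0.
Local Notation P := (triple_Pi A Pi0).
Local Notation S := (triple_S A S0 Pi0).

Let unitA : A \in unitmx.
Proof. by rewrite unitmxE unitfE; case: hadm. Qed.

Lemma triple_SS k : S k.+1 = S k + invmx A *m S k *m (invmx A) ^t* +
  invmx A *m P k *m (P k) ^t* *m (invmx A) ^t*.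
Proof. by rewrite adjmxV. Qed.

Lemma triple_PS k : P k.+1 = P k + 'i *: (invmx A *m P k *m jmx p).
Proof. by []. Qed.

Lemma dirac_WS (c : nat -> 'M[C]_(p + p)) l k : dirac_W c l k.+1 =
  (1%:M - ('i / l) *: (jmx p *m c k)) *m dirac_W c l k.
Proof. by []. Qed.

Lemma triple_identity k :
  A *m S k - S k *m A ^t* = 'i *: (P k *m jmx p *m (P k) ^t*).
Proof.
elim: k => [|k IH]; first by case: hadm.
exact: (darboux_identity (mulmxV unitA) (mulVmx unitA) jmx_sqr jmx_adj IH
  (triple_PS k) (triple_SS k)).
Qed.

(** Each step adds positive semidefinite terms to S. *)
Lemma triple_S_posdef k : posdefmx (S k).
Proof.
elim: k => [|k IH]; first by case: hadm.
have gramE : invmx A *m P k *m (P k) ^t* *m (invmx A) ^t* =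
          ((invmx A *m P k) ^t*) ^t* *m (invmx A *m P k) ^t*.
  by rewrite trmxCK adjmxM mulmxA.
rewrite triple_SS -addrA; apply: posdefmxD => //.
  by rewrite adjmxD gramE adjmx_congr ?(posdefmx_adj IH) // adjmx_gram.
move=> v; rewrite qformD; apply: addr_ge0.
  have -> : invmx A *m S k *m (invmx A) ^t* =
      ((invmx A) ^t*) ^t* *m S k *m (invmx A) ^t* by rewrite trmxCK.
  rewrite qform_congr.
  exact: posdefmx_ge0.
rewrite gramE; exact: qform_gram_ge0.
Qed.

(** If j e = - e, then a step multiplies e by 1 + i/l; so the first
component of the solution stays explicit. *)
Lemma triple_solution (c : nat -> 'M[C]_(p + p)) k l (E : 'M[C]_(p + p, k))
    (X : 'M[C]_(n, k)) r :
  (forall i, c i = triple_potential A S0 Pi0 i) -> l != 0 ->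
  jmx p *m E = - E -> A *m X - l *: X = Pi0 *m E ->
  exists2 Z, A *m Z - l *: Z = P r *m ((1 + 'i / l) ^+ r *: E) &
    dirac_W c l r *m (E - 'i *: (jmx p *m Pi0 ^t* *m invmx S0 *m X)) =
    (1 + 'i / l) ^+ r *: E - 'i *: (jmx p *m (P r) ^t* *m invmx (S r) *m Z).
Proof.
move=> hc l0 jE XE; elim: r => [|r [Z ZE WZ]].
  by exists X; rewrite expr0 scale1r //= mul1mx.
have uS i := posdefmx_unit (triple_S_posdef i).
set e := _ ^+ r *: E in ZE WZ.
have [Z' Z'E WZ'] := darboux_solution (mulmxV unitA) (mulVmx unitA) jmx_sqr jmx_adj
  (triple_identity r) (triple_PS r) (triple_SS r) (mulmxV (uS r))
  (mulVmx (uS r.+1)) (mulVmx (uS r)) l0 ZE.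
have e'E : e - ('i / l) *: (jmx p *m e) = (1 + 'i / l) ^+ r.+1 *: E.
  have -> : jmx p *m e = - e by rewrite -scalemxAr jE scalerN.
  by rewrite scalerN opprK exprS -scalerA scalerDl scale1r.
rewrite e'E in Z'E WZ'.
exists Z'; first exact: Z'E.
rewrite dirac_WS -(mulmxA _ (dirac_W c l r)) WZ; have -> := hc r.
exact: WZ'.
Qed.

(** Both terms of the energy are nonpositive: j E = - E makes the first one
minus a Gram matrix, and the factor of the second one is 2 Im l < 0. *)
Lemma triple_energy_le0 (c : nat -> 'M[C]_(p + p)) k l (E : 'M[C]_(p + p, k))
    (X : 'M[C]_(n, k)) r Y v :
  (forall i, c i = triple_potential A S0 Pi0 i) -> lower_half_plane l ->
  jmx p *m E = - E -> A *m X - l *: X = Pi0 *m E ->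
  Y = dirac_W c l r *m (E - 'i *: (jmx p *m Pi0 ^t* *m invmx S0 *m X)) ->
  qform (Y ^t* *m jmx p *m Y) v <= 0.
Proof.
move=> hc hl jE XE ->; have l0 := lower_half_plane_neq0 hl.
have [Z ZE WZ] := triple_solution r hc l0 jE XE.
have hS := triple_S_posdef r; have uS := posdefmx_unit hS.
have Siadj : (invmx (S r)) ^t* = invmx (S r) by rewrite adjmxV (posdefmx_adj hS).
rewrite WZ (darboux_energy jmx_sqr jmx_adj
  (triple_identity r) (mulmxV uS) (mulVmx uS) Siadj ZE).
rewrite qformD qformZ (qform_congr (invmx (S r))).
set e := _ *: E; have je : jmx p *m e = - e by rewrite -scalemxAr jE scalerN.
rewrite -(mulmxA (e ^t*)) je mulmxN qformN -[leRHS]addr0; apply: lerD.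
  rewrite oppr_le0; exact: qform_gram_ge0.
apply: mulr_le0_ge0; last exact/posdefmx_ge0/posdefmx_inv.
have -> : 'i * (l^* - l) = 2 * 'Im l by rewrite ImE [2 * _]mulrC divfK ?pnatr_eq0.
by rewrite pmulr_rle0 ?ltr0n //; exact: ltW.
Qed.

End Triple.

(** * The Weyl function of an admissible triple *)

Section TildeAlgebra.
Context {C : numClosedFieldType} {n p : nat}.
Variables (A S Si : 'M[C]_n) (t1 t2 : 'M[C]_(n, p)).
Hypotheses (Sadj : S ^t* = S) (SSi : S *m Si = 1%:M).
Local Notation j := (block_mx 1%:M 0 0 (- 1%:M) : 'M[C]_(p + p)).
Hypothesis AS : A *m S - S *m A ^t* =
  'i *: (row_mx t1 t2 *m j *m (row_mx t1 t2) ^t*).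
Local Notation At := (A + 'i *: (t2 *m (t2 - t1) ^t* *m Si)).

Let SiS : Si *m S = 1%:M. Proof. exact: mulmx1C. Qed.
Let Siadj : Si ^t* = Si. Proof. exact: right_inverse_adj SSi. Qed.

(** Adding i t2 (t2 - t1)^* S^-1 to A replaces the indefinite right-hand side
t1 t1^* - t2 t2^* by a square. *)
Lemma tilde_identity :
  At *m S - S *m At ^t* = 'i *: ((t1 - t2) *m (t1 - t2) ^t*).
Proof.
have AS' : A *m S = S *m A ^t* + 'i *: (t1 *m t1 ^t* - t2 *m t2 ^t*).
  apply/eqP; rewrite addrC -subr_eq AS; apply/eqP; congr (_ *: _).
  rewrite mul_row_block !mulmx0 !mulmx1 mulmxN mulmx1 addr0 add0r.
  by rewrite tr_row_mx map_col_mx mul_row_col mulNmx.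
rewrite !adjmxE Siadj conjCi; mxexpand; rewrite AS'.
by rewrite -!(mulmxA _ Si S) SiS SSi; mxexpand; mxlin.
Qed.

(** A resolvent equation for At is a resolvent equation for A whose
right-hand side is annihilated by 1 + j. *)
Lemma tilde_solution l k (G : 'M[C]_(p, k)) (X : 'M[C]_(n, k)) :
  At *m X - l *: X = t2 *m G ->
  A *m X - l *: X =
    row_mx t1 t2 *m col_mx 0 (G + 'i *: ((t1 - t2) ^t* *m Si *m X)).
Proof.
move=> XE; have -> : A *m X - l *: X =
    t2 *m G - 'i *: (t2 *m (t2 - t1) ^t* *m Si *m X).
  by rewrite -XE; mxexpand; mxlin.
rewrite mul_row_col mulmx0 add0r !adjmxE; mxexpand; mxlin.
Qed.

(** With X the resolvent of At applied to t2, the initial value defined by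
the explicit Weyl function is a multiple of the initial value of a solution of the
triple. *)
Lemma tilde_seed r (X : 'M[C]_(n, p)) :
  let K' : 'M[C]_(p + p) := r *: block_mx 1%:M 1%:M (- 1%:M) 1%:M in
  K' *m col_mx (- 'i *: (- 'i *: (1%:M + (2 * 'i) *: (t1 ^t* *m Si *m X)))) 1%:M
  = (2 * r) *: (col_mx 0 (1%:M + 'i *: ((t1 - t2) ^t* *m Si *m X))
      - 'i *: (j *m (row_mx t1 t2) ^t* *m Si *m X)).
Proof.
move=> K'; rewrite /K' -scalemxAl (mulrC 2 r) -(scalerA r); congr (_ *: _).
have -> : - 'i *: (- 'i *: (1%:M + (2 * 'i) *: (t1 ^t* *m Si *m X))) =
    - (1%:M + (2 * 'i) *: (t1 ^t* *m Si *m X)).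
  by rewrite scalerA mulrNN -expr2 sqrCi scaleN1r.
rewrite mul_block_col tr_row_mx map_col_mx mul_block_col !mul_col_mx.
rewrite !(scale_col_mx, opp_col_mx, add_col_mx) !mul0mx addr0 add0r.
congr col_mx; rewrite ?adjmxE; mxexpand; rewrite ?mul0mx; mxlin.
Qed.

End TildeAlgebra.

Section ExplicitWeylFunction.
Context {R : realType} {n p : nat}.
Local Notation C := (Cx R).
Variables (A S0 : 'M[C]_n) (t1 t2 : 'M[C]_(n, p)).
Hypothesis hadm : admissible A S0 (row_mx t1 t2).
Local Notation At := (A + 'i *: (t2 *m (t2 - t1) ^t* *m invmx S0)).

Definition tilde_resolvent l := invmx (At - l *: 1%:M).

Definition explicit_weyl l : 'M[C]_p :=
  - 'i *: (1%:M + (2 * 'i) *: (t1 ^t* *m invmx S0 *m (tilde_resolvent l *m t2))).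

Let hS0 : posdefmx S0. Proof. by case: hadm. Qed.
Let S0adj : S0 ^t* = S0. Proof. exact: posdefmx_adj. Qed.
Let S0V : S0 *m invmx S0 = 1%:M. Proof. exact/mulmxV/posdefmx_unit. Qed.
Let AS : A *m S0 - S0 *m A ^t* =
  'i *: (row_mx t1 t2 *m jmx p *m (row_mx t1 t2) ^t*).
Proof. by case: hadm. Qed.

(** For a left eigenvector w of At with eigenvalue l, the identity for At
gives 2 Im l (w^* S0 w) >= 0, so l is not in the lower half-plane. *)
Lemma tilde_shift_unit l : lower_half_plane l -> At - l *: 1%:M \in unitmx.
Proof.
move=> hl; apply: unitmx_inj => w; rewrite mulmxBr -scalemxAr mulmx1 => /eqP.
rewrite subr_eq0 => /eqP wAt; apply/eqP/negPn/negP => w0.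
have Q0 : 0 < qform S0 w by apply: hS0.2.
have := congr1 (fun M => qform M w) (tilde_identity S0adj S0V AS).
have G0 := qform_gram_ge0 ((t1 - t2) ^t*) w; rewrite trmxCK in G0.
rewrite (qform_left_eigen _ wAt) qformZ.
move=> E; have : 'Im l * (2 * qform S0 w) = qform ((t1 - t2) *m (t1 - t2) ^t*) w.
  apply: (mulfI (neq0Ci C)); rewrite mulrCA -E ImE.
  have -> : 'i * (l^* - l) / 2 * ('i * (2 * qform S0 w)) =
            'i * 'i * ((l^* - l) * qform S0 w) by field.
  by rewrite -expr2 sqrCi mulN1r -mulNr opprB.
move=> E2; have := G0; rewrite -E2 pmulr_lge0 ?mulr_gt0 ?ltr0n //.
by move=> /(lt_le_trans hl); rewrite ltxx.
Qed.

Lemma explicit_weyl_seed l : lower_half_plane l ->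
  exists a X E, [/\ jmx p *m E = - E, A *m X - l *: X = row_mx t1 t2 *m E &
    weyl_seed explicit_weyl l =
    a *: (E - 'i *: (jmx p *m (row_mx t1 t2) ^t* *m invmx S0 *m X))].
Proof.
move=> hl; pose X := tilde_resolvent l *m t2.
exists (2 * (sqrtC 2)^-1), X,
  (col_mx 0 (1%:M + 'i *: ((t1 - t2) ^t* *m invmx S0 *m X))).
split.
- rewrite /jmx mul_block_col !mul0mx !mulmx0 !add0r.
  by rewrite mulNmx mul1mx opp_col_mx oppr0.
- have : (At - l *: 1%:M) *m X = t2.
    by rewrite /X mulmxA mulmxV ?mul1mx // tilde_shift_unit.
  by rewrite mulmxBl -scalemxAl mul1mx -[t2 in _ = t2]mulmx1 => /tilde_solution.
- by rewrite /weyl_seed Kmx_adj; apply: tilde_seed.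
Qed.

Local Open Scope classical_set_scope.
(** By the energy identity the partial sums are bounded as soon as the
energies of the solution are nonpositive. *)
Lemma explicit_weyl_cvg (c : nat -> 'M[C]_(p + p)) l : dirac_potential c ->
  (forall k, c k = triple_potential A S0 (row_mx t1 t2) k) ->
  lower_half_plane l -> cvgn (series (weyl_term c explicit_weyl l)).
Proof.
move=> hdirac hc hl; have l0 := lower_half_plane_neq0 hl.
have rate0 := weyl_rate_gt0 hl; have q0 := ltW (weyl_q_gt0 l0).
set Y0 := weyl_seed explicit_weyl l.
have c0 k v : 0 <= qform (c k) v by apply: posdefmx_ge0; case: (hdirac k).
have term0 k v : 0 <= qform (weyl_term c explicit_weyl l k) v.
  rewrite weyl_termE qform_congr.
  exact: (density_ge0 (dirac_W c l) q0 c0).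
apply: (@cvg_series_psd _ _ _ (fun v =>
  (weyl_rate l)^-1 * - qform (jmx p) (Y0 *m v))) => // N v.
rewrite -(ler_pM2l rate0) mulrA mulfV ?gt_eqF // mul1r.
have := signature_energy (j := jmx p) (c := c) (W := dirac_W c l)
  (N := fun k => 1%:M - ('i / l) *: (jmx p *m c k)) erefl (fun k => erefl)
  (fun k => dirac_step k hdirac l0) N.
move=> /(congr1 (fun M => qform M (Y0 *m v))).
rewrite qformD !qformZ qform_sum.
have -> : \sum_(k < N) qform (weyl_term c explicit_weyl l k) v =
    \sum_(k < N) qform (weyl_q l ^+ k *:
      ((dirac_W c l k) ^t* *m c k *m dirac_W c l k)) (Y0 *m v).
  by apply: eq_bigr => k _; rewrite weyl_termE qform_congr.
move=> E; rewrite -subr_ge0 -opprD -E oppr_ge0.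
have [a [X [F [jF XF Y0E]]]] := explicit_weyl_seed hl.
set Z := F - _ in Y0E.
have -> : qform ((dirac_W c l N) ^t* *m jmx p *m dirac_W c l N) (Y0 *m v) =
    a * a^* * qform ((dirac_W c l N *m Z) ^t* *m jmx p *m (dirac_W c l N *m Z)) v.
  rewrite !qform_congr /Y0 Y0E -scalemxAl -scalemxAr mulmxA.
  exact: qform_scaled.
rewrite mulr_ge0_le0 ?exprn_ge0 // mulr_ge0_le0 ?mul_conjC_ge0 //.
exact: (@triple_energy_le0 _ _ _ _ _ _ hadm c _ l F X N _ v hc hl jF XF erefl).
Qed.

End ExplicitWeylFunction.

Section Holomorphy.
Local Open Scope classical_set_scope.
Context {R : realType} {n p : nat}.
Local Notation C := (Cx R).

(** By the resolvent identity the difference quotient is P r(l+h) r(l) Q,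
and the resolvent is continuous. *)
Lemma resolvent_derivable (M : 'M[C]_n) (P : 'M[C]_(p, n)) (Q : 'M[C]_(n, p))
    (N : 'M[C]_p) l : M - l *: 1%:M \in unitmx ->
  derivable (fun z : C => N + P *m invmx (M - z *: 1%:M) *m Q : 'M[C]_p) l 1.
Proof.
move=> uM; pose r (z : C) := invmx (M - z *: 1%:M).
have shift_cvg : (M - (h + l) *: 1%:M) @[h --> (0 : C)^'] --> M - l *: 1%:M.
  apply/cvg_mxP => i j; rewrite !mxE; under eq_cvg do rewrite !mxE.
  apply: cvgB; first exact: cvg_cst.
  apply: cvgM; last exact: cvg_cst.
  rewrite -[X in _ --> X]add0r; apply: cvgD; last exact: cvg_cst.
  exact: nbhs_dnbhs.
apply/cvg_ex; exists (P *m (r l *m r l) *m Q).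
have : (P *m (r (h + l) *m r l) *m Q) @[h --> (0 : C)^'] --> P *m (r l *m r l) *m Q.
  apply: cvg_mulmx; last exact: cvg_cst.
  apply: cvg_mulmx; first exact: cvg_cst.
  by apply: cvg_mulmx; [exact: cvg_invmx | exact: cvg_cst].
apply: cvg_trans; apply: near_eq_cvg.
have h0 : \forall h \near (0 : C)^', h != 0 by exact: nbhs_dnbhs_neq.
apply: filterS2 h0 (near_unitmx shift_cvg uM) => h h0 uh /=.
have res : r (h + l) - r l = h *: (r (h + l) *m r l).
  rewrite -[r l in LHS]mul1mx -[1%:M](mulVmx uh) -[r (h + l) in LHS]mulmx1.
  rewrite -[X in _ *m X - _](mulmxV uM) -/(r l) -/(r (h + l)).
  rewrite mulmxA -mulmxBl -mulmxBr.
  have -> : M - l *: 1%:M - (M - (h + l) *: 1%:M) = h *: 1%:M.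
    by rewrite scalerDl; mxlin.
  by rewrite -scalemxAr mulmx1 scalemxAl.
rewrite [h *: 1]mulr1 -/(r (h + l)) -/(r l).
rewrite opprD addrACA subrr add0r -mulmxBl -mulmxBr res.
by rewrite -scalemxAr -scalemxAl scalerA mulVf // scale1r.
Qed.

End Holomorphy.

Section WeylFunctionOfTriple.
Context {R : realType} {n p : nat}.
Local Notation C := (Cx R).
Variables (A S0 : 'M[C]_n) (t1 t2 : 'M[C]_(n, p)).
Hypothesis hadm : admissible A S0 (row_mx t1 t2).
Variable c : nat -> 'M[C]_(p + p).
Hypothesis hdirac : dirac_potential c.
Hypothesis hc : forall k, c k = triple_potential A S0 (row_mx t1 t2) k.

Lemma explicit_weyl_function : weyl_function c (explicit_weyl A S0 t1 t2).
Proof.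
split=> [l hl|l hl]; last exact: explicit_weyl_cvg.
have := @resolvent_derivable R n p _ (- 'i * (2 * 'i) *: (t1 ^t* *m invmx S0)) t2
  (- 'i *: 1%:M) l (tilde_shift_unit hadm hl).
congr (derivable _ l 1); apply/funext => z.
rewrite /explicit_weyl scalerDr scalerA; congr (_ + _).
by rewrite -!scalemxAl mulmxA.
Qed.

End WeylFunctionOfTriple.

(** * Taylor expansion of the Weyl function *)

Section CayleyPoint.
Context {R : realType}.
Local Notation C := (Cx R).

(** The imaginary part is (|z|^2 - 1) / |z - 1|^2. *)
Lemma disc_to_lower_half_plane (z : C) : `|z| < 1 ->
  lower_half_plane ('i * ((z + 1) / (z - 1))).
Proof.
move=> z1; have nz : z - 1 != 0.
  by rewrite subr_eq0; apply: contraTneq z1 => ->; rewrite normr1 ltxx.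
have cz : z^* - 1 != 0.
  by rewrite -[1]conjC1 -rmorphB conjC_eq0.
rewrite /lower_half_plane /= ImMil ReE rmorphM fmorphV /= rmorphB rmorphD /= conjC1.
have -> : ((z + 1) / (z - 1) + (z^* + 1) / (z^* - 1)) / 2 =
    (z * z^* - 1) / ((z - 1) * (z - 1)^*).
  by rewrite rmorphB /= conjC1; field; rewrite cz nz.
rewrite pmulr_llt0; last by rewrite invr_gt0 mul_conjC_gt0.
by rewrite -normCK subr_lt0 exprn_ilt1.
Qed.

End CayleyPoint.

Section CayleyTransform.
Context {C : numClosedFieldType} {n d : nat}.
Variables (T S Si : 'M[C]_n) (D : 'M[C]_(n, d)).
Hypotheses (Sadj : S ^t* = S) (SSi : S *m Si = 1%:M).
Hypotheses (S0 : forall v, 0 <= qform S v).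
Hypothesis TS : T *m S - S *m T ^t* = 'i *: (D *m D ^t*).
Hypothesis unitT : T + 'i *: 1%:M \in unitmx.
Local Notation B := (invmx (T + 'i *: 1%:M)).
Local Notation U := ((T - 'i *: 1%:M) *m B).

Let Siadj : Si ^t* = Si. Proof. exact: right_inverse_adj SSi. Qed.

Lemma cayley_comm : U = B *m (T - 'i *: 1%:M).
Proof.
have -> : T - 'i *: 1%:M = (T + 'i *: 1%:M) - (2 * 'i) *: 1%:M by mxlin.
rewrite mulmxBl mulmxBr mulmxV // mulVmx //.
by rewrite -scalemxAl -scalemxAr mul1mx mulmx1.
Qed.

(** The difference of (T + i) S (T + i)^* and (T - i) S (T - i)^* is - 2 i
times T S - S T^*, which makes it twice the Gram matrix of D^*. *)
Lemma cayley_contraction w : qform S (U ^t* *m w) <= qform S w.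
Proof.
rewrite -subr_ge0 -qform_congr trmxCK -qformN -qformD.
suff -> : S - U *m S *m U ^t* = 2 *: ((B *m D) *m (B *m D) ^t*).
  rewrite qformZ mulr_ge0 ?ler0n // -{1}[B *m D]trmxCK; exact: qform_gram_ge0.
have SE : S = B *m ((T + 'i *: 1%:M) *m S *m (T + 'i *: 1%:M) ^t*) *m B ^t*.
  rewrite -!mulmxA -adjmxM mulVmx // adjmx1 mulmx1.
  by rewrite mulmxA mulVmx // mul1mx.
rewrite [X in X - _]SE cayley_comm !adjmxE conjCi.
have -> : 2 *: (B *m D *m (D ^t* *m B ^t*)) =
          B *m (- (2 * 'i) *: ('i *: (D *m D ^t*))) *m B ^t*.
  rewrite scalerA mulNr -mulrA -expr2 sqrCi mulrN opprK mulr1.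
  by rewrite -scalemxAr -scalemxAl !mulmxA.
rewrite -TS; move: B (invmx _ ^t*) => b b'.
mxexpand; mxlin.
Qed.

Lemma cayley_exp_contraction k w : qform S ((U ^+ k) ^t* *m w) <= qform S w.
Proof.
elim: k w => [|k IH] w; first by rewrite expr0 adjmx1 mul1mx.
rewrite exprSr -mulmxE adjmxM -mulmxA.
exact: le_trans (cayley_contraction _) (IH _).
Qed.

(** An entry of U^k is the pairing of (U^k)^* e_i with e_j. The form S at
the first vector is bounded by contraction, so Cauchy-Schwarz bounds the pairing,
after rotating e_j by a phase that makes it a nonnegative real. *)
Lemma cayley_power_bound i j : exists c : C, forall k, `|(U ^+ k) i j| <= c.
Proof.
pose e l : 'cV[C]_n := delta_mx l 0.
exists ((qform S (e i) + qform Si (e j)) / 2) => k.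
set u := (U ^+ k) ^t* *m e i; set t := (U ^+ k) i j.
have uE : (u ^t* *m e j) 0 0 = t.
  by rewrite adjmxM trmxCK trmx_delta map_delta_mx -rowE -colE !mxE.
have uE' : ((e j) ^t* *m u) 0 0 = t^*.
  by rewrite -uE -[_ *m u]trmxCK adjmxM trmxCK !mxE.
have bound0 : 0 <= qform Si (e j).
  have -> : Si = Si ^t* *m S *m Si by rewrite Siadj -mulmxA SSi mulmx1.
  by rewrite qform_congr.
have [->|t0] := eqVneq t 0.
  by rewrite normr0 divr_ge0 ?ler0n // addr_ge0.
(* The phase for which a t = |t|. *)
pose a := t^* / `|t|.
have nt0 : `|t| != 0 by rewrite normr_eq0.
have aa : a * a^* = 1.
  rewrite /a rmorphM /= fmorphV /= conjCK (CrealP (normr_real t)).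
  by rewrite mulrACA -invfM -expr2 -normCKC divff // expf_neq0.
have at_ : a * t = `|t|.
  by rewrite /a mulrAC -normCKC expr2 mulfK.
have := cross_term_le u (a *: e j) Sadj Siadj SSi S0.
rewrite qform_scaled aa mul1r adjmxZ -scalemxAr -scalemxAl !scalemxE uE uE'.
have -> : a^* * t^* = `|t| by rewrite -rmorphM /= at_ (CrealP (normr_real t)).
rewrite at_ -mulr2n => le2.
rewrite ler_pdivlMr ?ltr0n // mulr_natr; apply: le_trans le2 _.
by rewrite lerD2r cayley_exp_contraction.
Qed.

(** From (1 - z)(T - l) = (1 - z U)(T + i) one gets V = (1 - z) B + z V U.
Iterating this relation produces the partial sums, with the remainder on the
right-hand side. *)
Lemma cayley_partial_sum z l (V : 'M[C]_n) N : z != 1 ->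
  l = 'i * ((z + 1) / (z - 1)) -> V *m (T - l *: 1%:M) = 1%:M ->
  V - (B + \sum_(1 <= k < N.+1) z ^+ k *: (B *m U ^+ (k - 1) *m (U - 1%:M))) =
  z *: ((V *m U - B) *m (z ^+ N *: U ^+ N)).
Proof.
move=> z1 lE VE; have z10 : z - 1 != 0 by rewrite subr_eq0.
have step : V - B = z *: (V *m U - B).
  have E : (1 - z) *: ((T - l *: 1%:M) *m B) = 1%:M - z *: U.
    have -> : 1%:M - z *: U = (T + 'i *: 1%:M - z *: (T - 'i *: 1%:M)) *m B.
      by rewrite [RHS]mulmxBl mulmxV // scalemxAl.
    rewrite scalemxAl; congr (_ *m _).
    have zl : (1 - z) * l = - ('i * (z + 1)) by rewrite lE; field.
    rewrite scalerBr scalerA zl; mxlin.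
  have H : (1 - z) *: B = V - z *: (V *m U).
    transitivity ((1 - z) *: (V *m ((T - l *: 1%:M) *m B))).
      by rewrite mulmxA VE mul1mx.
    by rewrite scalemxAr E mulmxBr mulmx1 -scalemxAr.
  have -> : V - B = V - z *: (V *m U) + z *: (V *m U) - B by rewrite subrK.
  by rewrite -H; mxlin.
move: U step => u step; move: B step => b step; elim: N => [|N IH].
  by rewrite big_geq // addr0 expr0 scale1r mulmx1.
rewrite big_nat_recr //= addrA opprD addrA IH subn1 /=.
have comm : u ^+ N *m (u - 1%:M) = (u - 1%:M) *m u ^+ N.
  by rewrite mulmxBr mulmxBl mulmx1 mul1mx !mulmxE -exprS -exprSr.
rewrite -[b *m u ^+ N *m _]mulmxA comm.
have -> : z *: ((V *m u - b) *m (z ^+ N.+1 *: u ^+ N.+1)) =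
          z ^+ N.+1 *: ((V - b) *m u *m u ^+ N).
  by rewrite step -!scalemxAl -scalemxAr !scalerA (mulrC z) (exprS u)
    -mulmxE !mulmxA.
rewrite -scalemxAr scalerA -exprS -scalerBr mulmxA -mulmxBl.
by congr (_ *: (_ *m _)); rewrite mulmxBl mulmxBr mulmx1; mxlin.
Qed.

End CayleyTransform.

Lemma sandwiched_partial_sum {C : numClosedFieldType} n p (L : 'M[C]_(p, n))
    (b u v : 'M[C]_n) (Q : 'M[C]_(n, p)) (X : 'M[C]_p) a z N :
  v - (b + \sum_(1 <= k < N.+1) z ^+ k *: (b *m u ^+ (k - 1) *m (u - 1%:M))) =
  z *: ((v *m u - b) *m (z ^+ N *: u ^+ N)) ->
  X + a *: (L *m b *m Q) + \sum_(1 <= k < N.+1) z ^+ k *: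
    (a *: (L *m b *m u ^+ (k - 1) *m (u - 1%:M) *m Q)) =
  X + a *: (L *m v *m Q) -
    (a * z) *: L *m (v *m u - b) *m (z ^+ N *: u ^+ N) *m Q.
Proof.
move=> vE.
have -> : \sum_(1 <= k < N.+1) z ^+ k *:
    (a *: (L *m b *m u ^+ (k - 1) *m (u - 1%:M) *m Q)) =
    a *: (L *m (\sum_(1 <= k < N.+1) z ^+ k *:
      (b *m u ^+ (k - 1) *m (u - 1%:M))) *m Q).
  rewrite mulmx_sumr mulmx_suml scaler_sumr; apply: eq_bigr => k _.
  by rewrite -scalemxAr -scalemxAl !mulmxA !scalerA mulrC.
set s := \sum_(1 <= k < N.+1) _ in vE *.
have -> : s = v - b - z *: ((v *m u - b) *m (z ^+ N *: u ^+ N)).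
  by rewrite -vE; mxlin.
mxexpand; mxlin.
Qed.

(** The remainder is a fixed matrix times z^N u^N, and z^N tends to 0 while
the powers of u stay bounded. *)
Lemma cvg_cayley_series {R : realType} n p (L : 'M[Cx R]_(p, n))
    (b u v : 'M[Cx R]_n) (Q : 'M[Cx R]_(n, p)) (X : 'M[Cx R]_p) (a z : Cx R) :
  (forall N, v - (b + \sum_(1 <= k < N.+1)
      z ^+ k *: (b *m u ^+ (k - 1) *m (u - 1%:M))) =
    z *: ((v *m u - b) *m (z ^+ N *: u ^+ N))) ->
  (forall i j, exists c, forall k, `|(u ^+ k) i j| <= c) -> `|z| < 1 ->
  ((fun N => X + a *: (L *m b *m Q) + \sum_(1 <= k < N) z ^+ k *:
    (a *: (L *m b *m u ^+ (k - 1) *m (u - 1%:M) *m Q))) @ \oo -->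
  X + a *: (L *m v *m Q))%classic.
Proof.
move=> vE bu z1.
set f := fun N => _.
have fE N : f N.+1 = X + a *: (L *m v *m Q) -
    (a * z) *: L *m (v *m u - b) *m (z ^+ N *: u ^+ N) *m Q.
  exact: sandwiched_partial_sum (vE N).
rewrite -(cvg_shiftS f) (_ : [sequence f n.+1]_n = fun N => X + a *: (L *m v *m Q) -
    (a * z) *: L *m (v *m u - b) *m (z ^+ N *: u ^+ N) *m Q); last exact/funext.
rewrite -[X + a *: (L *m v *m Q) in X in (_ --> X)%classic]subr0.
have -> : 0 = (a * z) *: L *m (v *m u - b) *m 0 *m Q by rewrite mulmx0 mul0mx.
apply: cvgB; first exact: cvg_cst.
apply: cvg_mulmx; last exact: cvg_cst.
apply: cvg_mulmx; first exact: cvg_cst.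
exact: cvg_scaled_powers.
Qed.

Section Expansion.
Local Open Scope classical_set_scope.
Context {R : realType} {n p : nat}.
Local Notation C := (Cx R).
Variables (A S0 : 'M[C]_n) (t1 t2 : 'M[C]_(n, p)).
Hypothesis hadm : admissible A S0 (row_mx t1 t2).
Local Notation At := (A + 'i *: (t2 *m (t2 - t1) ^t* *m invmx S0)).
Local Notation B := (invmx (At + 'i *: 1%:M)).
Local Notation U := ((At - 'i *: 1%:M) *m B).
Local Notation L := (t1 ^t* *m invmx S0).

Lemma tilde_cayley_unit : At + 'i *: 1%:M \in unitmx.
Proof.
rewrite -[_ *: 1%:M]opprK -scaleNr; apply: (tilde_shift_unit hadm).
by rewrite /lower_half_plane /= raddfN /= Im_i oppr_lt0 ltr01.
Qed.

Lemma explicit_weyl_taylor (z : C) : `|z| < 1 ->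
  (fun N => 1%:M + (2 * 'i) *: (L *m B *m t2) + \sum_(1 <= k < N) z ^+ k *:
     ((2 * 'i) *: (L *m B *m U ^+ (k - 1) *m (U - 1%:M) *m t2))) @ \oo -->
  ('i *: explicit_weyl A S0 t1 t2 ('i * ((z + 1) / (z - 1))) : 'M[C]_p).
Proof.
move=> z1; set l := 'i * _; pose V := tilde_resolvent A S0 t1 t2 l.
have [hid _ hS] := hadm.
have Sadj := posdefmx_adj hS; have SV := mulmxV (posdefmx_unit hS).
have zn1 : z != 1 by apply: contraTneq z1 => ->; rewrite normr1 ltxx.
have VE : V *m (At - l *: 1%:M) = 1%:M.
  by apply: mulVmx; apply: (tilde_shift_unit hadm); exact: disc_to_lower_half_plane.
have -> : 'i *: explicit_weyl A S0 t1 t2 l = 1%:M + (2 * 'i) *: (L *m V *m t2).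
  by rewrite /explicit_weyl scalerA mulrN -expr2 sqrCi opprK scale1r mulmxA.
apply: cvg_cayley_series z1 => [N|].
  exact: (@cayley_partial_sum _ _ _ tilde_cayley_unit z l V N zn1 erefl VE).
exact: (cayley_power_bound Sadj SV (fun v => posdefmx_ge0 v hS)
  (tilde_identity Sadj SV hid) tilde_cayley_unit).
Qed.

End Expansion.

(** * The block Toeplitz matrix of an admissible triple *)

Unset Implicit Arguments.
Set Strict Implicit.
Set Printing Implicit Defensive.

Theorem theorem4p2 (R : realType) (p n : nat) (hp : (0 < p)%N) (hn : (0 < n)%N)
    (A S0 : 'M[Cx R]_n) (theta1 theta2 : 'M[Cx R]_(n, p))
    (hadm : admissible A S0 (row_mx theta1 theta2))
    (c : nat -> 'M[Cx R]_(p + p)) (hdirac : dirac_potential c)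
    (hc : forall k : nat, c k = triple_potential A S0 (row_mx theta1 theta2) k) :
  let At := A + 'i *: (theta2 *m (theta2 - theta1) ^t* *m invmx S0) in
  let B := invmx (At + 'i *: 1%:M) in
  let U := (At - 'i *: 1%:M) *m B in
  (At + 'i *: 1%:M) \in unitmx /\
  forall (nu : 'M[Cx R]_p) (s : int -> 'M[Cx R]_p),
    toeplitz_data c nu s <->
    [/\ nu = Immx (1%:M + (2 * 'i) *: (theta1 ^t* *m invmx S0 *m B *m theta2)),
        s 0 = 2 *: Remx (1%:M
                + (2 * 'i) *: (theta1 ^t* *m invmx S0 *m B *m theta2)),
        forall k : nat, (1 <= k)%N ->
          s (- k%:Z) = (2 * 'i) *:
            (theta1 ^t* *m invmx S0 *m B
               *m U ^+ (k - 1) *m (U - 1%:M) *m theta2) &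
        forall k : int, s k = (s (- k)) ^t*].
Proof.
move=> At B U; split; first exact: tilde_cayley_unit hadm.
move=> nu s.
set s0 := 1%:M + _; set sk := fun k : nat => (2 * 'i) *: (theta1 ^t* *m invmx S0 *m B
  *m U ^+ (k - 1) *m (U - 1%:M) *m theta2).
have hweyl := explicit_weyl_function hadm hdirac hc.
have htaylor z := @explicit_weyl_taylor R n p A S0 theta1 theta2 hadm z.
split=> [[phi [al [[_ hphi] hal nuE s0E sE]]]|[nuE s0E skE sE]].
  have [alE sk'] : al = s0 /\ forall k, (0 < k)%N -> s (- k%:Z) = sk k.
    (* Both Weyl functions agree at the image of z, so the two expansions have
       the same sum. *)
    apply: (matrix_power_series_eq hal) => z z1.
    have hl := disc_to_lower_half_plane z1.
    have -> := weyl_value_unique hdirac hl (hphi _ hl) (hweyl.2 _ hl).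
    exact: htaylor.
  split=> //; first by rewrite nuE alE.
  by rewrite s0E alE /Remx scalerA mulfV ?pnatr_eq0 // scale1r.
exists (explicit_weyl A S0 theta1 theta2), s0; split=> //.
  move=> z z1; have := htaylor z z1; apply: cvg_trans.
  apply: near_eq_cvg; apply: nearW => N; congr (_ + _).
  apply: eq_big_nat => k /andP[k1 _]; congr (_ *: _); exact: esym (skE k k1).
by rewrite s0E /Remx scalerA mulfV ?pnatr_eq0 // scale1r.
Qed.
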